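(* Let $\alpha\ge1$, $b\ge0$, and let $$I_\alpha(r)=e^{-\pi\alpha r}\cdot\frac{r}{r+b},\qquad r>0.$$ Then the minimizer of $E_{I_\alpha}(L)$ among two-dimensional lattices $L$ of area $1$ exists and is always the hexagonal lattice.
   Context: For a potential $f:(0,\infty)\to\mathbb{R}$ and a two-dimensional lattice $L\subset\mathbb{R}^2$, $E_f(L)=\sum_{\mathbb{P}\in L\setminus\{0\}}f(|\mathbb{P}|^2)$, where $|\cdot|$ is the Euclidean norm. The hexagonal lattice of area $1$ is $\Lambda_1=\sqrt{\frac{2}{\sqrt3}}\,\big[\mathbb{Z}(1,0)\oplus\mathbb{Z}(\frac12,\frac{\sqrt3}{2})\big]$; lattices are identified up to isometry of $\mathbb{R}^2$. *)

(* Defs.v *)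
From mathcomp Require Import all_boot all_order all_algebra.
From mathcomp Require Import all_classical all_reals.
From mathcomp Require Import ereal esum sequences exp trigo.

Set Implicit Arguments.
Unset Strict Implicit.
Unset Printing Implicit Defensive.

Import Order.TTheory GRing.Theory Num.Theory.

Local Open Scope classical_set_scope.
Local Open Scope ring_scope.

Section Defs.
Variable R : realType.

(* The library norm on 'rV[R]_2 is the sup norm, hence this definition. *)
Definition enorm (P : 'rV[R]_2) : R := Num.sqrt (\sum_(i < 2) P 0 i ^+ 2).

Definition vec2 (x y : R) : 'rV[R]_2 := \row_(i < 2) (if i == 0 then x else y).

Definition basis_mx (u v : 'rV[R]_2) : 'M[R]_2 :=
  \matrix_(i < 2) (if i == 0 then u else v).

Definition zspan (u v : 'rV[R]_2) : set 'rV[R]_2 :=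
  [set P | exists m n : int, P = m%:~R *: u + n%:~R *: v].

(* The absolute determinant does not depend on the chosen basis, since two
   bases of L differ by an integer matrix of determinant 1 or -1. *)
Definition lattice_of_area (a : R) (L : set 'rV[R]_2) : Prop :=
  exists u v : 'rV[R]_2,
    [/\ basis_mx u v \in unitmx, L = zspan u v & `|\det (basis_mx u v)| = a].

Definition hexagonal_lattice : set 'rV[R]_2 :=
  [set Num.sqrt (2 / Num.sqrt 3) *: P |
     P in zspan (vec2 1 0) (vec2 (1 / 2) (Num.sqrt 3 / 2))].

Definition isometric (L L' : set 'rV[R]_2) : Prop :=
  exists2 g : 'rV[R]_2 -> 'rV[R]_2,
    (forall P Q, enorm (g P - g Q) = enorm (P - Q)) & g @` L = L'.

(* [esum] is meaningful for nonnegative families only, so the unordered sum is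
   split into positive and negative parts; for f >= 0 the second one is 0. *)
Definition energy (f : R -> R) (L : set 'rV[R]_2) : \bar R :=
  (\esum_(P in L `\ (0 : 'rV[R]_2)%R) (Num.max (f (enorm P ^+ 2)) 0)%R%:E
   - \esum_(P in L `\ (0 : 'rV[R]_2)%R) (Num.max (- f (enorm P ^+ 2)) 0)%R%:E)%E.

Definition minimizer (F : set 'rV[R]_2 -> \bar R) (C : set (set 'rV[R]_2))
    (L : set 'rV[R]_2) : Prop :=
  C L /\ forall L', C L' -> (F L <= F L')%E.

(* Only the values at r > 0 enter [energy]. *)
Definition Ipot (alpha b : R) (r : R) : R :=
  expR (- (pi * alpha * r)) * (r / (r + b)).

End Defs.

Arguments hexagonal_lattice R : clear implicits.

(* Main.v *)
From HB Require Import structures.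
From Stdlib Require Import ZArith.
Require Import Defs.
From mathcomp Require Import all_boot all_order all_algebra.
From mathcomp Require Import all_classical all_reals.
From mathcomp Require Import ereal esum sequences topology normedtype derive exp trigo.
From mathcomp Require Import ring lra zify ssrZ.

Set Implicit Arguments.
Unset Strict Implicit.
Unset Printing Implicit Defensive.

Import numFieldNormedType.Exports.
Import Order.TTheory GRing.Theory Num.Theory.
Local Open Scope classical_set_scope.
Local Open Scope ring_scope.

(** Write s = 2 / sqrt 3 for the squared length of the shortest vectors of the
hexagonal lattice, and beta = 157 / 50, a rational number slightly below pi.  The
potential is a constant times decay x * psi x, where decay x = x e^(- beta (x - s))
and psi is positive, nonincreasing and convex with psi s = 1 (a [profile]); alpha
and b only enter psi.  As psi lies above its tangent 1 - lam (x - s) at s, any finite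
set X of squared lengths of lattice vectors satisfies

   sum_X decay x * psi x >= sum_X decay x + lam * sum_X decay x * (s - x),

with some lam >= 0.  So if X satisfies sum_X decay x >= A and
sum_X decay x * (s - x) >= 0, two statements without alpha and b, then A bounds
the energy from below for all alpha and b at once ([finite_lower_bound]).

A lattice of area 1 has a basis e1, e2 with e1.e2 = - t, |e1|^2 = p, |e2|^2 = q,
0 <= 2 t <= p <= q and p q - t^2 = 1 ([reduced_basis]); the vectors e1, e2 and
e1 + e2 have the squared lengths p, q and r = p + q - 2 t.

- If p < 1/2, a few multiples of e1 are a sufficient X ([cusp_energy]).

- If p >= 1/2 and r > 1.37, the vectors of squared length p, q, r and p + q + 2 t
  are sufficient.  These lattices form a bounded two-parameter family on which both
  inequalities hold with room to spare, and a bisection with integer arithmetic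
  certifies them ([far_value], [far_slope], [far_energy]).

- If r <= 1.37, the lattice is close to the hexagonal one and no vector may be
  dropped.  Put S = p + q + r - 3 s, which is nonnegative.  Heron's formula turns
  the sum of the squares of p - s, q - s, r - s into s S + S^2 / 2, so a parabola
  below decay, tangent at s, yields a gain linear in S from these three vectors
  and their opposites ([near_value]).  The other vectors are grouped into orbits of the
  rotation of order three of the index lattice: over an orbit the mean squared
  length is N (p + q + r) / 3, against N s in the hexagonal lattice, and by convexity
  the orbits lose at most a multiple of S ([tail_comparison]) that is smaller than
  the gain.  Equality forces S = 0, hence p = q = r = s.

Thus every lattice has more energy than the hexagonal one, unless it has the same
Gram matrix, and then it is an isometric copy. *)

(** * Taylor bounds for the exponential, and a lower bound for pi *)

Section Exponential.
Variable R : realType.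
Implicit Types (x y w e : R) (n : nat).

Lemma ge0_of_derive (f f' : R -> R) :
  (forall x, is_derive x 1 f (f' x)) -> 0 <= f 0 ->
  (forall x, 0 <= x -> 0 <= f' x) -> forall x, 0 <= x -> 0 <= f x.
Proof.
move=> df f0 f'0 x; rewrite le_eqVlt => /predU1P[<-//|x0].
apply: (le_trans f0).
have fc : {within `[0, x], continuous f}.
  apply: continuous_subspaceT => y; apply: differentiable_continuous.
  by apply/derivable1_diffP; have [] := df y.
have [c] := MVT x0 (fun y _ => df y) fc.
rewrite in_itv/= => /andP[c0 _] /eqP; rewrite subr_eq => /eqP ->.
by rewrite lerDr subr0 mulr_ge0 ?f'0 ?ltW.
Qed.

(** The sign e lets one induction serve both half-lines: the derivative of the
remainder of order n.+1 is the remainder of order n. *)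
Lemma exp_taylor_sign e n w : e * e = 1 -> 0 <= w ->
  0 <= e ^+ n * (expR (e * w) - \sum_(k < n) (e * w) ^+ k / k`!%:R).
Proof.
move=> e2 w0.
pose P m : {poly R} := \poly_(k < m) (e ^+ k / k`!%:R).
have PE m y : (P m).[y] = \sum_(k < m) (e * y) ^+ k / k`!%:R.
  by rewrite horner_poly; apply: eq_bigr => k _; rewrite exprMn mulrAC.
have dP m : (P m.+1)^`() = e *: P m.
  apply/polyP => k; rewrite coef_deriv coefZ !coef_poly ltnS; case: ltnP => _; last first.
    by rewrite mul0rn mulr0.
  rewrite -mulr_natr factS natrM exprS invfM.
  by field; rewrite pnatr_eq0 -lt0n fact_gt0 /= nat1r pnatr_eq0.
rewrite -PE; elim: n w w0 => [|n IH] w w0.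
  by rewrite /P poly_def big_ord0 horner0 subr0 expr0 mul1r expR_ge0.
pose T m (y : R) := e ^+ m * (expR (e * y) - (P m).[y]).
apply: (@ge0_of_derive (T n.+1) (T n)) => //; last first.
  rewrite /T mulr0 expR0 PE big_ord_recl expr0 fact0 divr1 big1 ?addr0 ?subrr ?mulr0//.
  by move=> i _; rewrite expr0n mul0r.
move=> y; rewrite /T.
have dl : is_derive y 1 ( *%R e) e.
  by apply: is_derive_eq; rewrite scaler1.
apply: is_derive_eq.
rewrite /GRing.scale/= dP hornerZ exprS. ring: e2.
Qed.

Lemma exp_ge_taylor n x : ~~ odd n -> \sum_(k < n) x ^+ k / k`!%:R <= expR x.
Proof.
move=> n_even.
have [x0|/ltW x0] := leP 0 x.
  by have := @exp_taylor_sign 1 n x (mulr1 _) x0; rewrite expr1n !mul1r subr_ge0.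
have N1 : (-1 : R) * -1 = 1 by rewrite mulrNN mulr1.
have := @exp_taylor_sign (-1) n (- x) N1; rewrite -signr_odd (negbTE n_even) expr0.
by rewrite !mul1r mulrNN mul1r subr_ge0; apply; rewrite oppr_ge0.
Qed.

Lemma exp_ge3 x : 1 + x + x ^+ 2 / 2 + x ^+ 3 / 6 <= expR x.
Proof.
apply: le_trans (@exp_ge_taylor 4 x isT).
by rewrite !big_ord_recr big_ord0 /= !factS fact0 le_eqVlt; apply/orP; left; apply/eqP; field.
Qed.

Lemma exp_ge5 x : 1 + x + x ^+ 2 / 2 + x ^+ 3 / 6 + x ^+ 4 / 24 + x ^+ 5 / 120 <= expR x.
Proof.
apply: le_trans (@exp_ge_taylor 6 x isT).
by rewrite !big_ord_recr big_ord0 /= !factS fact0 le_eqVlt; apply/orP; left; apply/eqP; field.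
Qed.

End Exponential.

Section Pi.
Variable R : realType.

(** The terms of the cosine series after x^6 have positive sums two by two. *)
Lemma cos_gt_taylor (x : R) : 0 < x <= 1 ->
  1 - x ^+ 2 / 2 + x ^+ 4 / 24 - x ^+ 6 / 720 < cos x.
Proof.
move=> /andP[x0 x1]; have h := @cvg_cos_coeff' R x; rewrite -(cvg_lim (@Rhausdorff R) h).
rewrite [ltLHS](_ : _ = \sum_(0 <= i < 4) cos_coeff' x i); last first.
  rewrite !big_nat_recr//= big_nil /cos_coeff' /= !factS fact0 !natrM.
  by rewrite -!exprnP; field.
apply: lt_sum_lim_series; [by move/cvgP in h|move=> d].
have o1 : odd (4 + d.*2) = false by rewrite oddD odd_double.
have o2 : odd (4 + d.*2.+1) = true by rewrite addnS oddS o1.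
rewrite /cos_coeff' -!exprnP -(signr_odd _ (4 + d.*2)) -(signr_odd _ (4 + d.*2.+1)).
rewrite o1 o2 expr0 expr1.
rewrite mul1r mulN1r mulNr subr_gt0 ltr_pdivrMr ?ltr0n ?fact_gt0//.
rewrite mulrAC ltr_pdivlMr ?ltr0n ?fact_gt0//.
apply: (@le_lt_trans _ _ (x ^+ (4 + d.*2).*2 * (4 + d.*2).*2`!%:R)).
  rewrite ler_pM2r ?ltr0n ?fact_gt0//; apply: ler_wiXn2l => //; first exact: ltW.
  by rewrite leq_double leq_add2l.
rewrite ltr_pM2l ?exprn_gt0// ltr_nat ltn_pfact; first by rewrite ltn_double ltn_add2l.
all: by rewrite inE.
Qed.

(** If pi < 3.14 then cos (0.785) < cos (pi / 4), whose square is 1/2; the Taylor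
polynomial at 0.785 is too large for that. *)
Lemma pi_ge314 : (157 / 50 : R) <= pi.
Proof.
rewrite leNgt; apply/negP => pilt.
have pi2 := pi_ge2 R.
have c1 : cos (157 / 200 : R) < cos (pi / 4).
  rewrite ltr_cos ?in_itv/=; [|apply/andP; split..]; lra.
have c2 : (7073 / (100 * 100) : R) < cos (157 / 200).
  apply: lt_trans (@cos_gt_taylor (157/200) _); lra.
have c3 : cos (pi / 4 : R) ^+ 2 * 2 = 1.
  have := @cos_mulr2n R (pi / 4); rewrite (_ : pi / 4 *+ 2 = pi / 2 :> R); last by field.
  by rewrite cos_pihalf; lra.
by nra.
Qed.
End Pi.

(** * The function x e^(- beta x) near the hexagonal length *)

Section Parabola.
Variable R : realFieldType.

(** The shape of [parabola_gap_ge0], with coefficients known up to intervals. *)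
Lemma quartic_ge0 (z c0 c1 c2 c3 c4 : R) : - 23 / 50 <= z <= 14 / 65 ->
  247/1000 <= c0 -> - 103/100 <= c1 <= - 257/250 -> - 49/100 <= c2 <= 0 -> 0 <= c3 <= 28/25 ->
  0 <= c4 <= 51/20 -> (0 <= z -> 0 <= c3 - z * c4) ->
  0 <= c0 + z * c1 + z^+2 * c2 + z^+3 * c3 - z^+4 * c4.
Proof.
move=> /andP[z1 z2] c0b /andP[c1l c1u] /andP[c2l c2u] /andP[c3l c3u] /andP[c4l c4u] c3z.
have [z0|z0] := leP 0 z.
  have e1 : 0 <= z * (c1 + 103/100) by apply: mulr_ge0 => //; lra.
  have e2 : 0 <= z ^+ 2 * (c2 + 49/100) by apply: mulr_ge0; [exact: sqr_ge0|lra].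
  have e3 : 0 <= z ^+ 3 * (c3 - z * c4) by apply: mulr_ge0; [exact: exprn_ge0|exact: c3z].
  have e4 : 0 <= z * (14/65 - z) by apply: mulr_ge0; lra.
  lra.
have e1 : 0 <= (- z) * (- 257/250 - c1) by apply: mulr_ge0; lra.
have e2 : 0 <= z ^+ 2 * (c2 + 49/100) by apply: mulr_ge0; [exact: sqr_ge0|lra].
have e3 : 0 <= (- z) ^+ 3 * (28/25 - c3) by apply: mulr_ge0; [apply: exprn_ge0|]; lra.
have e4 : 0 <= z ^+ 4 * (51/20 - c4) by apply: mulr_ge0; [rewrite -[4%N]/(2*2)%N exprM; exact: sqr_ge0|lra].
have e5 : 0 <= - z * (z + 23/50) by apply: mulr_ge0; lra.
have e6 : 0 <= z ^+ 2 * (z + 23/50) by apply: mulr_ge0; [exact: sqr_ge0|lra].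
have e7 : 0 <= (- z) ^+ 3 * (z + 23/50) by apply: mulr_ge0; [apply: exprn_ge0|]; lra.
lra.
Qed.

(** Up to the factor z^2, this is the gap at s + z between the fifth Taylor bound of
[decay] and the parabola of [decay_parabola]. *)
Lemma parabola_gap_ge0 (s z : R) : 209 / 181 <= s <= 97 / 84 -> - 23 / 50 <= z <= 14 / 65 ->
  0 <= ((157/50)^+2 * s / 2 - 157/50 - 461/200)
   + z * ((157/50)^+2/2 - (157/50)^+3 * s / 6)
   + z^+2 * ((157/50)^+4 * s / 24 - (157/50)^+3/6)
   + z^+3 * ((157/50)^+4 / 24 - (157/50)^+5 * s/120)
   - z^+4 * ((157/50)^+5 / 120).
Proof.
move=> sb zb; apply: quartic_ge0 => //; [clear zb; lra..|].
by case/andP: zb => _ z1 z0; lra.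
Qed.
End Parabola.

Section DecaySec.
Variable R : realType.
Implicit Types (x y w z : R).

(** The squared length of the shortest vectors of the hexagonal lattice of area 1. *)
Definition hexlen : R := 2 / Num.sqrt 3.
Local Notation s := hexlen.

Lemma hexlen2 : s ^+ 2 = 4 / 3.
Proof. by rewrite expr_div_n sqr_sqrtr//; field. Qed.
Lemma hexlen_gt0 : 0 < s.
Proof. by rewrite divr_gt0// sqrtr_gt0. Qed.
Lemma hexlen_bounds : 209 / 181 <= s <= 97 / 84.
Proof. by have := hexlen2; have := hexlen_gt0; move: s => t t0 t2; apply/andP; split; nra. Qed.

(** The exponent is a rational number below pi, so that only the lower bound
[pi_ge314] of pi is ever needed; the factor e^(157/50 s) makes [decay s = s]. *)
Definition decay x : R := x * expR (- (157 / 50 * (x - s))).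
Local Notation h := decay.

Lemma decay_gt0 x : 0 < x -> 0 < h x.
Proof. by move=> x0; rewrite mulr_gt0 ?expR_gt0. Qed.

Lemma decay_hexlen : h s = s.
Proof. by rewrite /decay subrr mulr0 oppr0 expR0 mulr1. Qed.

(** The logarithmic derivative 1 / x - 157 / 50 vanishes at 50 / 157. *)
Lemma decay_anti x y : 50 / 157 <= x -> x <= y -> h y <= h x.
Proof.
move=> x0 xy; have xp : 0 < x by lra.
rewrite /decay (_ : expR (- (157 / 50 * (x - s))) = expR (157/50 * (y - x)) * expR (- (157 / 50 * (y - s)))); last first.
  by rewrite -expRD; congr expR; ring.
rewrite mulrA ler_pM2r ?expR_gt0//.
apply: (@le_trans _ _ (x * (1 + 157/50 * (y - x)))); first nra.
by rewrite ler_pM2l// expR_ge1Dx.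
Qed.

Lemma decay_incr x y : 0 < x -> x <= y -> y <= 50 / 157 -> h x <= h y.
Proof.
move=> x0 xy y0; have yp : 0 < y by lra.
rewrite /decay (_ : expR (- (157 / 50 * (y - s))) = expR (- (157/50 * (y - x))) * expR (- (157 / 50 * (x - s)))); last first.
  by rewrite -expRD; congr expR; ring.
rewrite mulrA ler_pM2r ?expR_gt0//.
apply: (@le_trans _ _ (y * (1 - 157/50 * (y - x)))); first nra.
by rewrite ler_pM2l// expR_ge1Dx.
Qed.

(** The curvature 461 / 200 has to exceed the slope at s divided by s, about 2.274,
for [near_value] to give a gain, and a parabola above about 2.318 would cross the
graph of [decay] before x = 1.37. *)
Lemma decay_parabola x : 7 / 10 <= x <= 137 / 100 ->
  s - (157 / 50 * s - 1) * (x - s) + 461 / 200 * (x - s) ^+ 2 <= h x.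
Proof.
move=> xI; have sb := hexlen_bounds.
have x0 : 0 < x by lra.
rewrite /decay; move: (s) sb => t tb.
apply: (@le_trans _ _ (x * (1 + (- (157 / 50 * (x - t))) + (- (157 / 50 * (x - t))) ^+ 2 / 2
  + (- (157 / 50 * (x - t))) ^+ 3 / 6 + (- (157 / 50 * (x - t))) ^+ 4 / 24
  + (- (157 / 50 * (x - t))) ^+ 5 / 120))); last by rewrite ler_pM2l ?exp_ge5.
have zI : - 23 / 50 <= x - t <= 14 / 65 by lra.
rewrite -subr_ge0; apply: le_trans (mulr_ge0 (sqr_ge0 (x - t)) (parabola_gap_ge0 tb zI)) _.
by rewrite le_eqVlt; apply/orP; left; apply/eqP; field.
Qed.

(** Around s the left side is s (s - x) + (s - x)^2; with this coefficient of the
square, the terms of first order in the excess cancel in [near_slope]. *)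
Lemma decay_slope x : 7 / 10 <= x <= 137 / 100 ->
  (2 * s - x) * (s - x) <= decay x * (s - x).
Proof.
move=> xI; have sb := hexlen_bounds.
have [xs|sx] := leP x s.
  apply: ler_wpM2r; first by rewrite subr_ge0.
  apply: le_trans (decay_parabola xI); move: (s) sb xs => t tb xt.
  have t1 : 0 <= (t - x) * (157 / 50 * t - 2) by apply: mulr_ge0; lra.
  have := sqr_ge0 (x - t); lra.
apply: ler_wnM2r; first by rewrite subr_le0 ltW.
have x0 : 0 < x by lra.
have xE : decay x * expR (157 / 50 * (x - s)) = x.
  by rewrite /decay -mulrA -expRD addNr expR0 mulr1.
have h0 := decay_gt0 x0.
have e1 : decay x * (1 + 157 / 50 * (x - s)) <= x.
  by rewrite -[leRHS]xE ler_pM2l// expR_ge1Dx.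
move: (s) (decay x) sb sx h0 e1 {xE} => t k tb tx k0 e1.
have t1 : 0 <= (x - t) * (157 / 50 * t - 2 - 157 / 50 * (x - t)) by apply: mulr_ge0; lra.
have t2 : 0 < 1 + 157 / 50 * (x - t) by lra.
rewrite -(ler_pM2r t2); apply: (le_trans e1); lra.
Qed.

(** The hypothesis is Heron's formula for a triangle of area 1/2 with squared sides
p, q, r, that is, half a cell of a lattice of area 1. *)
Lemma heron_defect p q r : 2 * (p * q + q * r + r * p) - (p ^+ 2 + q ^+ 2 + r ^+ 2) = 4 ->
  (p - s) ^+ 2 + (q - s) ^+ 2 + (r - s) ^+ 2 =
  s * (p + q + r - 3 * s) + (p + q + r - 3 * s) ^+ 2 / 2.
Proof. by move=> H; have := hexlen2; move: (s) => t t2; lra. Qed.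

Lemma heron_sum_ge p q r : 0 < p -> 0 < q -> 0 < r ->
  2 * (p * q + q * r + r * p) - (p ^+ 2 + q ^+ 2 + r ^+ 2) = 4 ->
  3 * s <= p + q + r.
Proof.
move=> p0 q0 r0 H; rewrite -(@ler_pXn2r _ 2) ?nnegrE//; last 2 first.
- by rewrite mulr_ge0 ?ltW ?hexlen_gt0.
- by rewrite !addr_ge0 ?ltW.
rewrite exprMn hexlen2.
have := sqr_ge0 (p - q); have := sqr_ge0 (q - r); have := sqr_ge0 (r - p); lra.
Qed.

(** By [heron_defect] the three parabolas add up to a linear function of the excess
p + q + r - 3 s plus a square; its slope 1 - (157/50 - 461/200) s exceeds 7/200. *)
Lemma near_value p q r :
  7 / 10 <= p <= 137 / 100 -> 7 / 10 <= q <= 137 / 100 -> 7 / 10 <= r <= 137 / 100 ->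
  2 * (p * q + q * r + r * p) - (p ^+ 2 + q ^+ 2 + r ^+ 2) = 4 ->
  3 * s + 7 / 200 * (p + q + r - 3 * s) <= h p + h q + h r.
Proof.
move=> pI qI rI H.
have S0 : 3 * s <= p + q + r by apply: heron_sum_ge H; lra.
have := heron_defect H.
have := decay_parabola pI; have := decay_parabola qI; have := decay_parabola rI.
have sb := hexlen_bounds.
move: (h p) (h q) (h r) ((p - s)^+2) ((q-s)^+2) ((r-s)^+2) => hp hq hr p2 q2 r2.
move: (s) sb S0 => t tb S0 h1 h2 h3 h4 {H pI qI rI}.
have e1 : 0 <= (p + q + r - 3 * t) * (193/200 - 167/200 * t) by apply: mulr_ge0; lra.
have := sqr_ge0 (p + q + r - 3 * t); lra.
Qed.

Lemma near_slope p q r :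
  7 / 10 <= p <= 137 / 100 -> 7 / 10 <= q <= 137 / 100 -> 7 / 10 <= r <= 137 / 100 ->
  2 * (p * q + q * r + r * p) - (p ^+ 2 + q ^+ 2 + r ^+ 2) = 4 ->
  0 <= h p * (s - p) + h q * (s - q) + h r * (s - r).
Proof.
move=> pI qI rI H; have := heron_defect H.
have := decay_slope pI; have := decay_slope qI; have := decay_slope rI.
move: (h p * _) (h q * _) (h r * _) => hp hq hr.
move: (s) => t h1 h2 h3 h4 {H pI qI rI}.
have := sqr_ge0 (p + q + r - 3 * t); lra.
Qed.

(** [decay] is convex beyond 100 / 157, the double of the place of its maximum. *)
Lemma decay_tangent c x : 3 * s <= c -> 100 / 157 <= x ->
  h c * (1 - (157 / 50 - c^-1) * (x - c)) <= h x.
Proof.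
move=> c3 x0; have sb := hexlen_bounds.
have c0 : 0 < c by lra.
have xp : 0 < x by lra.
rewrite /decay (_ : expR (- (157 / 50 * (x - s))) = expR (- (157 / 50 * (x - c))) * expR (- (157 / 50 * (c - s)))); last first.
  by rewrite -expRD; congr expR; ring.
rewrite mulrAC mulrA ler_pM2r ?expR_gt0//.
rewrite (_ : c * _ = c + (x - c) - 157/50 * (x - c) * c); last by field; exact: lt0r_neq0.
set w := 157 / 50 * (x - c).
have xE : x = c + 50 / 157 * w by rewrite /w; field.
rewrite (_ : x - c = 50/157 * w); last by rewrite /w; field.
have [w0|w0] := leP w 0.
  apply: (@le_trans _ _ (x * (1 - w + w ^+ 2 / 2))).
    have e1 : 0 <= w ^+ 2 * (x / 2 - 50/157) by apply: mulr_ge0; [exact: sqr_ge0|lra].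
    rewrite xE in e1 *; lra.
  rewrite ler_pM2l//; have := exp_ge3 (- w).
  have : 0 <= (- w) ^+ 3 by apply: exprn_ge0; lra.
  lra.
(* Where the tangent is negative there is nothing to prove, so w is bounded. *)
have [w2|w2] := leP (c + 50/157 * w - w * c) 0.
  by apply: (le_trans w2); rewrite mulr_ge0 ?expR_ge0 ?ltW.
have c34 : 34 / 10 <= c by lra.
have w3 : w <= 12/10.
  rewrite leNgt; apply/negP => w3.
  have : 0 <= (w - 12/10) * (c - 50/157) by apply: mulr_ge0; lra.
  lra.
apply: (@le_trans _ _ (x * (1 - w + w ^+ 2 / 2 - w ^+ 3 / 6))); last first.
  by rewrite ler_pM2l//; have := exp_ge3 (- w); lra.
rewrite xE.
have e1 : 0 <= w ^+ 2 * (c / 2 - 50 / 157 + w * (25/157 - c / 6) - w ^+ 2 * (50/942)).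
  apply: mulr_ge0; first exact: sqr_ge0.
  have : 0 <= (12/10 - w) * (c/6 - 25/157) by apply: mulr_ge0; lra.
  have : 0 <= (12/10 - w) * w by apply: mulr_ge0; lra.
  lra.
lra.
Qed.

End DecaySec.

(** * Integer arithmetic and a table of exponentials *)

Delimit Scope Z_scope with BZ.

(** Locked, for otherwise simplification would expand large integers into unary
numbers. *)
HB.lock Definition zr (R : realType) (k : Z) : R := (int_of_Z k)%:~R.

Section IntegerCast.
Variable R : realType.
Local Notation zr := (zr R).

Lemma zrD a b : zr (a + b)%BZ = zr a + zr b.
Proof. by rewrite !unlock -[(a + b)%BZ]/(a + b)%R !rmorphD. Qed.
Lemma zrN a : zr (- a)%BZ = - zr a.
Proof. by rewrite !unlock -[(- a)%BZ]/(- a)%R !rmorphN. Qed.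
Lemma zrB a b : zr (a - b)%BZ = zr a - zr b.
Proof. by rewrite -Z.add_opp_r zrD zrN. Qed.
Lemma zrM a b : zr (a * b)%BZ = zr a * zr b.
Proof. by rewrite !unlock -[(a * b)%BZ]/(a * b)%R !rmorphM. Qed.

Lemma zr1 : zr 1%BZ = 1. Proof. by rewrite unlock. Qed.
Lemma zr_nat n : zr (Z.of_nat n) = n%:R.
Proof. by rewrite !unlock -[Z.of_nat n]/(Z_of_int (Posz n)) Z_of_intK. Qed.
Lemma zr_ge0 a : (0 <= a)%BZ -> 0 <= zr a.
Proof. by move=> a0; rewrite -(Z2Nat.id a a0) zr_nat ler0n. Qed.
Lemma zr_le a b : (a <= b)%BZ -> zr a <= zr b.
Proof. by move=> ab; rewrite -subr_ge0 -zrB zr_ge0//; lia. Qed.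
Lemma zr_gt0 a : (0 < a)%BZ -> 0 < zr a.
Proof. by move=> a0; apply: (@lt_le_trans _ _ (zr 1%BZ)); [rewrite zr1|apply: zr_le; lia]. Qed.

Lemma zr_div_le a b : (0 < b)%BZ -> zr (a / b)%BZ <= zr a / zr b.
Proof.
move=> b0; rewrite ler_pdivlMr ?zr_gt0// -zrM; apply: zr_le.
by rewrite Z.mul_comm; apply: Z.mul_div_le.
Qed.
Lemma zr_div_ge a b : (0 < b)%BZ -> zr a / zr b <= zr (a / b + 1)%BZ.
Proof.
move=> b0; rewrite ler_pdivrMr ?zr_gt0// -zrM; apply: zr_le.
have := Z.mul_succ_div_gt a b b0; lia.
Qed.

(** [exp_num a b / exp_den b] is the fifth Taylor polynomial of the exponential at
a / b. *)
Definition exp_num a b := (120 * (b * b * b * b * b) + 120 * a * (b * b * b * b)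
  + 60 * (a * a) * (b * b * b) + 20 * (a * a * a) * (b * b) + 5 * (a * a * a * a) * b
  + a * a * a * a * a)%BZ.
Definition exp_den b := (120 * (b * b * b * b * b))%BZ.

Lemma exp_ge_num a b : (0 < b)%BZ -> zr (exp_num a b) / zr (exp_den b) <= expR (zr a / zr b).
Proof.
move=> b0; apply: le_trans (exp_ge5 _).
have bn : zr b != 0 by rewrite gt_eqF ?zr_gt0.
rewrite /exp_num /exp_den !zrD !zrM.
rewrite -[120%BZ]/(Z.of_nat 120) -[60%BZ]/(Z.of_nat 60) -[20%BZ]/(Z.of_nat 20) -[5%BZ]/(Z.of_nat 5).
rewrite !zr_nat.
by rewrite le_eqVlt; apply/orP; left; apply/eqP; field.
Qed.
End IntegerCast.

Section ExpTable.
Local Open Scope Z_scope.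

Definition denom : Z := 8192.
Definition scale : Z := Eval vm_compute in 2 ^ 40.
(** The integer part of scale * e^(- 157/6400); the exponent is that of [decay] on a
length 1/128, that is, 64 steps of size 1 / denom. *)
Definition exp_factor : Z := 1072867377692.

Definition exp_step (t : Z) : Z := t * exp_factor / scale.
Fixpoint exp_steps (n : nat) (t : Z) : seq Z :=
  if n is n'.+1 then t :: exp_steps n' (exp_step t) else [::].
Definition exp_table : seq Z := Eval vm_compute in exp_steps 410 scale.

Lemma exp_tableE : exp_table = exp_steps 410 scale.
Proof. by vm_compute. Qed.

Lemma nth_exp_steps z n t k : (k < n)%N -> nth z (exp_steps n t) k = iter k exp_step t.
Proof.
elim: n t k => // n IH t [|k] //= kn.
by rewrite IH// -iterSr.
Qed.

Lemma exp_step_bounds (t : Z) : 0 <= t <= scale -> 0 <= exp_step t <= scale.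
Proof.
move=> t0; rewrite /exp_step; split.
  by apply: Z.div_pos => //; rewrite /exp_factor; lia.
apply: Z.div_le_upper_bound => //; rewrite /exp_factor /scale in t0 *; lia.
Qed.

Lemma iter_exp_step_bounds k : 0 <= iter k exp_step scale <= scale.
Proof. by elim: k => [|k IH] //=; exact: exp_step_bounds. Qed.
End ExpTable.

Section ExpTableSound.
Variable R : realType.
Local Notation zr := (zr R).
Local Notation v := (157 / (64 * 100) : R).

Lemma exp_factor_le : zr exp_factor <= zr scale * expR (- v).
Proof.
have zE : zr (- 157)%BZ / zr 6400%BZ = - v.
  rewrite -[6400%BZ]/(Z.of_nat 64 * Z.of_nat 100)%BZ -[(- 157)%BZ]/(Z.opp (Z.of_nat 157)).
  by rewrite zrM zrN !zr_nat mulNr.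
rewrite -zE mulrC -ler_pdivrMr ?zr_gt0//.
apply: le_trans (@exp_ge_num R (- 157)%BZ 6400%BZ _) => //.
rewrite ler_pdivrMr ?zr_gt0// mulrAC ler_pdivlMr ?zr_gt0// -!zrM.
apply: zr_le; exact/Z.leb_le.
Qed.

Lemma exp_factor_ge : zr scale * expR (- v) <= zr (exp_factor + 2)%BZ.
Proof.
have vE : zr 157%BZ / zr 6400%BZ = v.
  by rewrite -[6400%BZ]/(Z.of_nat 64 * Z.of_nat 100)%BZ -[157%BZ]/(Z.of_nat 157) zrM !zr_nat.
rewrite expRN -vE ler_pdivrMr ?expR_gt0//.
apply: (@le_trans _ _ (zr (exp_factor + 2)%BZ * (zr (exp_num 157%BZ 6400%BZ) / zr (exp_den 6400%BZ)))).
  rewrite mulrA ler_pdivlMr ?zr_gt0// -!zrM.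
  apply: zr_le; exact/Z.leb_le.
by rewrite ler_pM2l ?zr_gt0// exp_ge_num.
Qed.

Lemma exp_table_low k : zr (iter k exp_step scale) <= zr scale * expR (- (k%:R * v)).
Proof.
elim: k => [|k IH]; first by rewrite mul0r oppr0 expR0 mulr1.
rewrite /= /exp_step; apply: (le_trans (zr_div_le _ _ _)) => //.
rewrite ler_pdivrMr ?zr_gt0// zrM -natr1 mulrDl mul1r opprD expRD.
rewrite [leRHS](_ : _ = (zr scale * expR (- (k%:R * v))) * (zr scale * expR (- v))); last by ring.
by apply: ler_pM; rewrite ?exp_factor_le ?zr_ge0//; case: (iter_exp_step_bounds k).
Qed.

(** A step loses at most one unit by rounding and two by the error of
[exp_factor]. *)
Lemma exp_table_high k :
  zr scale * expR (- (k%:R * v)) <= zr (iter k exp_step scale + 3 * Z.of_nat k)%BZ.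
Proof.
elim: k => [|k IH]; first by rewrite mul0r oppr0 expR0 mulr1.
have s0 : 0 < zr scale by exact: zr_gt0.
rewrite -(ler_pM2r s0) -natr1 mulrDl mul1r opprD expRD.
rewrite [leLHS](_ : _ = (zr scale * expR (- (k%:R * v))) * (zr scale * expR (- v))); last by ring.
have e0 y : 0 <= zr scale * expR y by rewrite mulr_ge0 ?expR_ge0 ?ltW.
apply: le_trans (ler_pM (e0 _) (e0 _) IH exp_factor_ge) _.
rewrite -!zrM; apply: zr_le; rewrite iterS.
have := iter_exp_step_bounds k; move: (iter k _ _) => t [t0 t1].
rewrite /exp_step; have := Z.mul_succ_div_gt (t * exp_factor) scale.
move: (t * exp_factor / scale)%BZ => u; rewrite /scale /exp_factor in t1 *; lia.
Qed.

End ExpTableSound.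

Section Bounds.
Local Open Scope Z_scope.
(** The functions below bound [unit_of_decay * decay x / expR (157/50 * hexlen)] for
x near k / denom. *)
Definition unit_of_decay : Z := scale * (50 * denom) * denom.
(** The table gives the multiples of 64; in between, the exponential is replaced by
its tangent 1 - (157/50) (k mod 64) / denom. *)
Definition exp_low (k : Z) : Z :=
  nth 0 exp_table (Z.to_nat (k / 64)) * (50 * denom - 157 * (k mod 64)).
Definition decay_low (k : Z) : Z := k * exp_low k.
(** Rounding the exponent down to a multiple of 64 is precise enough here; 3 (k / 64)
is the error of [exp_table_high]. *)
Definition decay_high (k : Z) : Z :=
  k * (nth scale exp_table (Z.to_nat (k / 64)) + 3 * (k / 64)) * (50 * denom).
Definition hexlen_low : Z := Eval vm_compute in 209 * denom / 181.
(** For x between lo / denom and hi / denom, the factor s - x is at least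
s - hi / denom, and the sign of the latter decides on which side to bound
[decay x]. *)
Definition slope_low (lo hi : Z) : Z :=
  (hexlen_low - hi) * (if hi <=? hexlen_low then decay_low hi else decay_high lo).
End Bounds.

Section BoundsSound.
Variable R : realType.
Local Notation zr := (zr R).
Local Notation s := (hexlen R).
Local Notation d := (zr denom).
Local Notation E := (expR (157 / 50 * s)).
Local Notation K := (zr unit_of_decay).

Lemma denomE : d = 64 * 128.
Proof. by rewrite -[denom]/(Z.of_nat 64 * Z.of_nat 128)%BZ zrM !zr_nat. Qed.

Lemma denom_gt0 : 0 < d.
Proof. exact: zr_gt0. Qed.

Lemma decayE (y : R) : decay y = y * expR (- (157 / 50 * y)) * E.
Proof. by rewrite /decay -[RHS]mulrA -expRD; congr (_ * expR _); ring. Qed.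

Lemma divmod64 k : (0 <= k)%BZ ->
  zr k = (Z.to_nat (k / 64))%:R * 64 + zr (k mod 64)%BZ.
Proof.
move=> k0; rewrite -zr_nat Z2Nat.id; last by apply: Z.div_pos.
rewrite -[64](@zr_nat R 64) -zrM -zrD; congr zr.
by rewrite {1}(Z.div_mod k 64) // -[Z.of_nat 64]/64%BZ; lia.
Qed.

Lemma nth_exp_table z a : (a < 410)%N -> nth z exp_table a = iter a exp_step scale.
Proof. by move=> a410; rewrite exp_tableE nth_exp_steps. Qed.

Lemma size_exp_table : size exp_table = 410. Proof. by vm_compute. Qed.

Lemma scale_gt0 : 0 < zr scale. Proof. exact: zr_gt0. Qed.

Lemma exp_low_sound k : (0 <= k)%BZ ->
  zr (exp_low k) <= zr (scale * (50 * denom))%BZ * expR (- (157 / 50 * (zr k / d))).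
Proof.
move=> k0; rewrite /exp_low (divmod64 k0).
have b0 : (0 <= k mod 64 < 64)%BZ by apply: Z.mod_pos_bound.
move: (Z.to_nat _) (k mod 64)%BZ b0 => a b b0.
have [a410|a410] := ltnP a 410; last first.
  rewrite nth_default ?size_exp_table// Z.mul_0_l (@zr_nat R 0).
  by rewrite mulr_ge0 ?expR_ge0 ?zr_ge0.
rewrite nth_exp_table// (_ : - _ = - (a%:R * (157 / (64 * 100))) + - (157 / 50 * (zr b / d))); last first.
  by rewrite denomE; field.
rewrite expRD !zrM [leRHS](_ : _ = (zr scale * expR (- (a%:R * (157 / (64 * 100))))) * (zr 50%BZ * d * expR (- (157 / 50 * (zr b / d))))); last by ring.
apply: ler_pM.
- by apply: zr_ge0; case: (iter_exp_step_bounds a).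
- by apply: zr_ge0; rewrite /denom; lia.
- exact: exp_table_low.
rewrite zrB !zrM.
apply: (@le_trans _ _ (zr 50%BZ * d * (1 + - (157 / 50 * (zr b / d))))); last first.
  by rewrite ler_pM2l ?expR_ge1Dx// mulr_gt0 ?zr_gt0.
rewrite -[50%BZ]/(Z.of_nat 50) -[157%BZ]/(Z.of_nat 157) !zr_nat.
by rewrite le_eqVlt; apply/orP; left; apply/eqP; field; rewrite gt_eqF ?denom_gt0.
Qed.

Lemma decay_low_sound k (y : R) : 50 / 157 <= y -> y <= zr k / d ->
  zr (decay_low k) * E <= K * decay y.
Proof.
move=> y0 yk; have yp : 0 < y by lra.
have k0 : (0 <= k)%BZ.
  case: (Z.le_gt_cases 0 k) => // kn; exfalso; move: (lt_le_trans yp yk).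
  by rewrite pmulr_lgt0 ?invr_gt0 ?denom_gt0// ltNge -oppr_ge0 -zrN zr_ge0//; lia.
apply: (@le_trans _ _ (K * decay (zr k / d))); last first.
  by rewrite ler_pM2l ?zr_gt0// decay_anti.
rewrite decayE mulrA ler_pM2r ?expR_gt0// /decay_low /unit_of_decay !(zrM _ _ denom) zrM.
rewrite [leRHS](_ : _ = zr k * (zr (scale * (50 * denom))%BZ * expR (- (157 / 50 * (zr k / d))))).
  by apply: ler_wpM2l; [exact: zr_ge0|exact: exp_low_sound].
by field; rewrite gt_eqF ?denom_gt0.
Qed.

Lemma decay_high_sound k (y : R) : 50 / 157 <= zr k / d -> zr k / d <= y ->
  K * decay y <= zr (decay_high k) * E.
Proof.
move=> k1 ky; have k0 : (0 <= k)%BZ.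
  case: (Z.le_gt_cases 0 k) => // kn; exfalso.
  have : 0 < zr k / d by lra.
  by rewrite pmulr_lgt0 ?invr_gt0 ?denom_gt0// ltNge -oppr_ge0 -zrN zr_ge0//; lia.
apply: (@le_trans _ _ (K * decay (zr k / d))).
  by rewrite ler_pM2l ?zr_gt0// decay_anti.
rewrite decayE mulrA ler_pM2r ?expR_gt0// /decay_high /unit_of_decay.
rewrite !zrM [leLHS](_ : _ = zr k * (zr scale * expR (- (157 / 50 * (zr k / d)))) * (zr 50%BZ * d)); last first.
  by field; rewrite gt_eqF ?denom_gt0.
rewrite ler_pM2r ?mulr_gt0 ?zr_gt0// ler_wpM2l ?zr_ge0//.
apply: (@le_trans _ _ (zr scale * expR (- ((Z.to_nat (k / 64))%:R * (157 / (64 * 100)))))).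
  rewrite ler_pM2l ?scale_gt0// ler_expR lerN2 (divmod64 k0) denomE.
  have : 0 <= zr (k mod 64)%BZ by apply: zr_ge0; case: (Z.mod_pos_bound k 64).
  lra.
have [a410|a410] := ltnP (Z.to_nat (k / 64)) 410; last first.
  rewrite nth_default ?size_exp_table//; apply: (@le_trans _ _ (zr scale)).
    rewrite ger_pMr ?scale_gt0// expR_le1 oppr_le0 mulr_ge0//.
  apply: zr_le; have := Z.div_pos k 64 k0; lia.
rewrite nth_exp_table//; apply: le_trans (exp_table_high _ _) _.
by rewrite Z2Nat.id//; apply: Z.div_pos.
Qed.

Lemma hexlen_low_le : zr hexlen_low <= s * d.
Proof.
have := hexlen_bounds R => /andP[s1 _].
rewrite -ler_pdivrMr ?denom_gt0//; apply: le_trans s1.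
rewrite -[209](@zr_nat R 209) -[181](@zr_nat R 181) ler_pdivrMr ?denom_gt0// mulrAC.
rewrite ler_pdivlMr ?zr_gt0// -!zrM; apply: zr_le; exact/Z.leb_le.
Qed.

Lemma slope_low_sound lo hi (y : R) : 50 / 157 <= zr lo / d ->
  zr lo / d <= y <= zr hi / d ->
  zr (slope_low lo hi) * E <= K * d * (decay y * (s - y)).
Proof.
move=> lo0 /andP[loy yhi]; rewrite /slope_low zrM.
have hy : 0 <= decay y by apply/ltW/decay_gt0; lra.
have e1 : zr (hexlen_low - hi) <= d * (s - y).
  rewrite zrB; have := hexlen_low_le; move: yhi; rewrite ler_pdivlMr ?denom_gt0//; lra.
rewrite [leRHS](_ : _ = (d * (s - y)) * (K * decay y)); last by ring.
apply: (@le_trans _ _ (zr (hexlen_low - hi) * (K * decay y))); last first.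
  by apply: ler_wpM2r => //; rewrite mulr_ge0 ?zr_ge0.
rewrite -mulrA; case: Z.leb_spec => c.
  apply: ler_wpM2l; first by apply: zr_ge0; lia.
  by apply: decay_low_sound => //; lra.
apply: ler_wnM2l; last exact: decay_high_sound.
by rewrite -oppr_ge0 -zrN zr_ge0//; lia.
Qed.

End BoundsSound.

(** * Certified bisection *)

Section Cells.
Local Open Scope Z_scope.
Implicit Types p x w : Z.

(** Bounds, in units of 1 / denom, of [len p o] below for p between p1 / denom
and p2 / denom and o at most, respectively at least, w / denom; adding 1 makes
up for the rounding of the quotients. *)
Definition len_high (p1 p2 w : Z) : Z :=
  denom * denom / p1 + 1 + (p2 * (w * w) / (denom * denom) + 1).
Definition len_low (p1 p2 w : Z) : Z :=
  denom * denom / p2 + p1 * (w * w) / (denom * denom).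

(** The limit 1.37 between lattices near to and far from the hexagonal one. *)
Definition near_cut : Z := Eval vm_compute in 137 * denom / 100.
(** Slightly more than the value of the hexagonal lattice, see
[hex_bound_le_far]. *)
Definition value_target : Z := Eval vm_compute in 37 * unit_of_decay / 400 + 1.

Definition value_lower_bound (p1 p2 x1 x2 : Z) : Z :=
  decay_low p2 + decay_low (len_high p1 p2 x2) +
  decay_low (len_high p1 p2 (denom - x1)) + decay_low (len_high p1 p2 (denom + x2)).

Definition slope_lower_bound (p1 p2 x1 x2 : Z) : Z :=
  slope_low p1 p2 + slope_low (len_low p1 p2 x1) (len_high p1 p2 x2) +
  slope_low (len_low p1 p2 (denom - x2)) (len_high p1 p2 (denom - x1)) +
  slope_low (len_low p1 p2 (denom + x1)) (len_high p1 p2 (denom + x2)).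

(** A cell may be skipped if all its lattices are near the hexagonal one, or if none
of them has its shortest vector of squared length p.  The bound 2609 ensures that
[decay] is decreasing from p1 / denom on. *)
Definition cell_ok (good : Z -> Z -> Z -> Z -> bool) (p1 p2 x1 x2 : Z) : bool :=
  if (2609 <=? p1) && (0 <=? x1) && (x2 <=? denom) then
    if len_high p1 p2 (denom - x1) <=? near_cut then true
    else if len_high p1 p2 x2 <? p1 then true
    else good p1 p2 x1 x2
  else false.

(** Nested conditionals, because an evaluation by value would compute both arguments
of a boolean connective, and so the whole tree.  The bounds of a cell depend more
on p than on x, hence the factors 2 and 3. *)
Fixpoint covers (good : Z -> Z -> Z -> Z -> bool) (n : nat) (p1 p2 x1 x2 : Z) : bool :=
  if cell_ok good p1 p2 x1 x2 then true
  else if n is n'.+1 then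
    if 2 * (x2 - x1) <? 3 * (p2 - p1) then
      let m := (p1 + p2) / 2 in
      if covers good n' p1 m x1 x2 then covers good n' m p2 x1 x2 else false
    else
      let m := (x1 + x2) / 2 in
      if covers good n' p1 p2 x1 m then covers good n' p1 p2 m x2 else false
  else false.

(** The cell is 1/2 <= p <= 9460/8192, 0 <= x <= 1/2; the upper limit of p exceeds
97/84, hence s. *)
Lemma value_covers :
  covers (fun p1 p2 x1 x2 => value_target <=? value_lower_bound p1 p2 x1 x2)
    24 4096 9460 0 4096 = true.
Proof. by vm_compute. Qed.

Lemma slope_covers :
  covers (fun p1 p2 x1 x2 =>
      (2609 <=? len_low p1 p2 x1) && (2609 <=? len_low p1 p2 (denom - x2)) &&
      (2609 <=? len_low p1 p2 (denom + x1)) && (0 <=? slope_lower_bound p1 p2 x1 x2))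
    24 4096 9460 0 4096 = true.
Proof. by vm_compute. Qed.

End Cells.

Section CellsSound.
Variable R : realType.
Local Notation zr := (zr R).
Local Notation s := (hexlen R).
Local Notation d := (zr denom).
Local Notation E := (expR (157 / 50 * s)).
Local Notation K := (zr unit_of_decay).
Implicit Types p x o : R.

Definition in_cell (a1 a2 b1 b2 : Z) p x :=
  zr a1 <= p * d <= zr a2 /\ zr b1 <= x * d <= zr b2.

(** In a lattice of area 1 with a vector e of squared length p, the vectors on the
line next to the multiples of e have squared lengths [len p o], where o runs over
a class of numbers modulo 1. *)
Definition len p o : R := p^-1 + p * o ^+ 2.

Lemma len_high_sound a1 a2 w p o : (0 < a1)%BZ -> zr a1 <= p * d <= zr a2 ->
  0 <= o -> o * d <= zr w -> len p o <= zr (len_high a1 a2 w) / d.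
Proof.
move=> a10 /andP[pl ph] o0 ow; have d0 := denom_gt0 R.
have z1 : 0 < zr a1 by exact: zr_gt0.
have p0 : 0 < p by have := lt_le_trans z1 pl; rewrite pmulr_lgt0.
rewrite ler_pdivlMr// mulrDl /len_high zrD; apply: lerD.
  apply: le_trans (zr_div_ge _ _ a10).
  rewrite zrM ler_pdivlMr// (_ : d * d = p^-1 * d * (p * d)); last by field; rewrite gt_eqF.
  by rewrite ler_pM2l// mulr_gt0 ?invr_gt0.
apply: le_trans (@zr_div_ge R _ _ _) => //.
rewrite ler_pdivlMr ?zr_gt0// !zrM (_ : p * _ * _ * _ = (p * d) * ((o * d) * (o * d))); last by ring.
by apply: ler_pM => //; [exact: le_trans (ltW z1) pl|rewrite !mulr_ge0 ?(ltW d0)|apply: ler_pM; rewrite ?mulr_ge0 ?(ltW d0)].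
Qed.

Lemma len_low_sound a1 a2 w p o : (0 < a1)%BZ -> zr a1 <= p * d <= zr a2 ->
  (0 <= w)%BZ -> zr w <= o * d -> zr (len_low a1 a2 w) / d <= len p o.
Proof.
move=> a10 /andP[pl ph] w0 ow; have d0 := denom_gt0 R.
have z1 : 0 < zr a1 by exact: zr_gt0.
have z2 : 0 < zr a2 by exact: lt_le_trans z1 (le_trans pl ph).
have p0 : 0 < p by have := lt_le_trans z1 pl; rewrite pmulr_lgt0.
have a20 : (0 < a2)%BZ.
  case: (Z.lt_ge_cases 0 a2) => // a2n; exfalso; move: z2.
  by rewrite ltNge -oppr_ge0 -zrN zr_ge0//; lia.
rewrite ler_pdivrMr// mulrDl /len_low zrD; apply: lerD.
  apply: le_trans (zr_div_le _ _ a20) _.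
  rewrite zrM ler_pdivrMr// (_ : d * d = p^-1 * d * (p * d)); last by field; rewrite gt_eqF.
  by rewrite ler_pM2l// mulr_gt0 ?invr_gt0.
apply: le_trans (@zr_div_le R _ _ _) _ => //.
rewrite ler_pdivrMr ?zr_gt0// !zrM (_ : p * _ * _ * _ = (p * d) * ((o * d) * (o * d))); last by ring.
by apply: ler_pM => //; rewrite ?mulr_ge0 ?zr_ge0//; [lia|apply: ler_pM; rewrite ?zr_ge0].
Qed.

Lemma coversP (good : Z -> Z -> Z -> Z -> bool) (P : R -> R -> Prop) :
  (forall a1 a2 b1 b2 p x, cell_ok good a1 a2 b1 b2 -> in_cell a1 a2 b1 b2 p x -> P p x) ->
  forall n a1 a2 b1 b2, covers good n a1 a2 b1 b2 ->
  forall p x, in_cell a1 a2 b1 b2 p x -> P p x.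
Proof.
move=> okP; elim=> [|n IH] a1 a2 b1 b2 /=; case: ifP => // ok.
- by move=> _ p x; exact: okP ok.
- by move=> _ p x; exact: okP ok.
case: ifP => _; case: ifP => // c1 c2 p x [/andP[pl ph] /andP[xl xh]].
- have [le|/ltW ge] := leP (p * d) (zr ((a1 + a2) / 2)%BZ).
    by apply: IH c1 _ _ _; split; apply/andP.
  by apply: IH c2 _ _ _; split; apply/andP.
- have [le|/ltW ge] := leP (x * d) (zr ((b1 + b2) / 2)%BZ).
    by apply: IH c1 _ _ _; split; apply/andP.
  by apply: IH c2 _ _ _; split; apply/andP.
Qed.

Lemma cell_okP good a1 a2 b1 b2 p x : cell_ok good a1 a2 b1 b2 ->
  in_cell a1 a2 b1 b2 p x -> p <= len p x -> 137 / 100 < len p (1 - x) ->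
  [/\ (2609 <= a1)%BZ, (0 <= b1)%BZ, (b2 <= denom)%BZ & good a1 a2 b1 b2].
Proof.
rewrite /cell_ok; case: ifP => // /andP[/andP[/Z.leb_spec0 a10 /Z.leb_spec0 b10] /Z.leb_spec0 b2d].
move=> ok [pI /andP[xl xh]] pq rfar; split=> //; move: ok.
have a1p : (0 < a1)%BZ by lia.
have x0 : 0 <= x by have := le_trans (zr_ge0 R b10) xl; rewrite pmulr_lge0 ?denom_gt0.
have x1 : x <= 1.
  by have := le_trans xh (zr_le R b2d); rewrite -{2}[d]mul1r ler_pM2r ?denom_gt0.
case: Z.leb_spec => [near|_].
  exfalso; move: rfar; rewrite ltNge => /negP; apply.
  apply: le_trans (@len_high_sound a1 a2 (denom - b1) p (1 - x) a1p pI _ _) _.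
  - by rewrite subr_ge0.
  - by rewrite zrB mulrBl mul1r lerD2l lerN2.
  apply: (@le_trans _ _ (zr near_cut / d)).
    by rewrite ler_pM2r ?invr_gt0 ?denom_gt0// zr_le.
  rewrite -[137](@zr_nat R 137) -[100](@zr_nat R 100) ler_pdivrMr ?denom_gt0// mulrAC.
  rewrite ler_pdivlMr ?zr_gt0// -!zrM; apply: zr_le; exact/Z.leb_le.
case: Z.ltb_spec => // qp; exfalso; move: pq; rewrite leNgt => /negP; apply.
apply: le_lt_trans (len_high_sound a1p pI x0 xh) _.
rewrite ltr_pdivrMr ?denom_gt0//; case/andP: pI => pl _; apply: lt_le_trans pl.
by rewrite -subr_gt0 -zrB zr_gt0//; lia.
Qed.

Lemma domain_in_cell p x : 1 / 2 <= p <= 97 / 84 -> 0 <= x <= 1 / 2 ->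
  in_cell 4096%BZ 9460%BZ 0%BZ 4096%BZ p x.
Proof.
move=> /andP[p1 p2] /andP[x1 x2]; have dE := denomE R; have d0 := denom_gt0 R.
have e1 : zr 4096%BZ = d / 2.
  by rewrite -[denom]/(4096 * Z.of_nat 2)%BZ zrM zr_nat; field.
have e2 : 97 / 84 * d <= zr 9460%BZ.
  rewrite -[97](@zr_nat R 97) -[84](@zr_nat R 84) mulrAC ler_pdivrMr ?zr_gt0// -!zrM.
  by apply: zr_le; exact/Z.leb_le.
have p3 : p * d <= 97 / 84 * d by rewrite ler_pM2r.
have p4 : 1 / 2 * d <= p * d by rewrite ler_pM2r.
have x3 : x * d <= 1 / 2 * d by rewrite ler_pM2r.
have x4 : 0 <= x * d by rewrite mulr_ge0// ltW.
split; apply/andP; split.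
- by rewrite e1; lra.
- exact: le_trans e2.
- by rewrite (@zr_nat R 0).
- by rewrite e1; lra.
Qed.

Lemma len_mono p x y : 0 < p -> 0 <= x -> 0 <= y -> x <= y -> len p x <= len p y.
Proof.
by move=> p0 x0 y0 xy; rewrite /len lerD2l ler_pM2l// ler_pXn2r ?nnegrE.
Qed.

Lemma inv_beta_le k : (2609 <= k)%BZ -> 50 / 157 <= zr k / d.
Proof.
move=> k0; rewrite ler_pdivlMr ?denom_gt0// -[50](@zr_nat R 50) -[157](@zr_nat R 157).
rewrite mulrAC ler_pdivrMr ?zr_gt0// -!zrM; apply: zr_le.
by rewrite /denom -[Z.of_nat 50]/50%BZ -[Z.of_nat 157]/157%BZ; lia.
Qed.

Lemma far_value p x : 1 / 2 <= p <= 97 / 84 -> 0 <= x <= 1 / 2 ->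
  p <= len p x -> 137 / 100 < len p (1 - x) ->
  37 / 400 * E < decay p + decay (len p x) + decay (len p (1 - x)) + decay (len p (1 + x)).
Proof.
move=> pI xI; have := domain_in_cell pI xI; move: p x {pI xI}.
apply: (coversP _ value_covers) => a1 a2 b1 b2 p x ok inc pq rfar.
have [a10 b10 b2d good] := cell_okP ok inc pq rfar.
case: inc => pI xI; case/andP: (xI) => xl xh; case/andP: (pI) => pl ph.
have a1p : (0 < a1)%BZ by lia.
have d0 := denom_gt0 R.
have x0 : 0 <= x by have := le_trans (zr_ge0 R b10) xl; rewrite pmulr_lge0.
have x1 : x <= 1 by have := le_trans xh (zr_le R b2d); rewrite -{2}[d]mul1r ler_pM2r.
have p0 : 50 / 157 <= p.
  by apply: le_trans (inv_beta_le a10) _; rewrite ler_pdivrMr.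
have r0 : 50 / 157 <= len p (1 - x) by lra.
have rr0 : 50 / 157 <= len p (1 + x).
  by apply: le_trans r0 _; apply: len_mono; lra.
have h1 := @decay_low_sound R a2 p p0; rewrite ler_pdivlMr// in h1.
have h2 := decay_low_sound (le_trans p0 pq) (len_high_sound a1p pI x0 xh).
have h3 := decay_low_sound r0 (@len_high_sound a1 a2 (denom - b1) p (1 - x) a1p pI _ _).
have h4 := decay_low_sound rr0 (@len_high_sound a1 a2 (denom + b2) p (1 + x) a1p pI _ _).
have K0 : 0 < K by exact: zr_gt0.
have E0 : 0 < E by exact: expR_gt0.
rewrite -(ltr_pM2l K0) !(mulrDr K).
apply: (@lt_le_trans _ _ (zr value_target * E)).
  rewrite mulrA ltr_pM2r//.
  rewrite -[37](@zr_nat R 37) -[400](@zr_nat R 400) mulrA ltr_pdivrMr ?zr_gt0// -!zrM.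
  by rewrite -subr_gt0 -zrB zr_gt0//; exact/Z.ltb_lt.
apply: (@le_trans _ _ (zr (value_lower_bound a1 a2 b1 b2) * E)).
  by rewrite ler_pM2r// zr_le//; exact/Z.leb_le.
rewrite /value_lower_bound !zrD !(mulrDl _ _ E).
apply: lerD; [apply: lerD; [apply: lerD|]|].
- exact: h1 ph.
- exact: h2.
- apply: h3; first by rewrite subr_ge0.
  by rewrite zrB mulrBl mul1r lerD2l lerN2.
- apply: h4; first by rewrite addr_ge0.
  by rewrite zrD mulrDl mul1r lerD2l.
Qed.

Lemma far_slope p x : 1 / 2 <= p <= 97 / 84 -> 0 <= x <= 1 / 2 ->
  p <= len p x -> 137 / 100 < len p (1 - x) ->
  0 <= decay p * (s - p) + decay (len p x) * (s - len p x)
    + decay (len p (1 - x)) * (s - len p (1 - x))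
    + decay (len p (1 + x)) * (s - len p (1 + x)).
Proof.
move=> pI xI; have := domain_in_cell pI xI; move: p x {pI xI}.
apply: (coversP _ slope_covers) => a1 a2 b1 b2 p x ok inc pq rfar.
have [a10 b10 b2d] := cell_okP ok inc pq rfar.
move=> /andP[/andP[/andP[/Z.leb_spec0 l1 /Z.leb_spec0 l2] /Z.leb_spec0 l3] /Z.leb_spec0 good].
case: inc => pI xI; case/andP: (xI) => xl xh; case/andP: (pI) => pl ph.
have a1p : (0 < a1)%BZ by lia.
have w1 : (0 <= denom - b2)%BZ by lia.
have w2 : (0 <= denom + b1)%BZ by rewrite /denom; lia.
have d0 := denom_gt0 R.
have x0 : 0 <= x by have := le_trans (zr_ge0 R b10) xl; rewrite pmulr_lge0.
have x1 : x <= 1 by have := le_trans xh (zr_le R b2d); rewrite -{2}[d]mul1r ler_pM2r.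
have K0 : 0 < K * d by rewrite mulr_gt0// zr_gt0.
have E0 : 0 < E by exact: expR_gt0.
rewrite -(pmulr_rge0 _ K0) !(mulrDr (K * d)).
apply: (@le_trans _ _ (zr (slope_lower_bound a1 a2 b1 b2) * E)).
  by rewrite mulr_ge0 ?expR_ge0// zr_ge0.
have dx1 : (1 - x) * d <= zr (denom - b1)%BZ by rewrite zrB mulrBl mul1r lerD2l lerN2.
have dx2 : zr (denom - b2)%BZ <= (1 - x) * d by rewrite zrB mulrBl mul1r lerD2l lerN2.
have dx3 : (1 + x) * d <= zr (denom + b2)%BZ by rewrite zrD mulrDl mul1r lerD2l.
have dx4 : zr (denom + b1)%BZ <= (1 + x) * d by rewrite zrD mulrDl mul1r lerD2l.
rewrite /slope_lower_bound !zrD !(mulrDl _ _ E).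
apply: lerD; [apply: lerD; [apply: lerD|]|].
- apply: slope_low_sound; first exact: inv_beta_le.
  by rewrite ler_pdivrMr// ler_pdivlMr// pl.
- apply: slope_low_sound; first exact: inv_beta_le.
  by rewrite len_low_sound// len_high_sound.
- apply: slope_low_sound; first exact: inv_beta_le.
  apply/andP; split; first exact: len_low_sound.
  by apply: len_high_sound => //; rewrite subr_ge0.
- apply: slope_low_sound; first exact: inv_beta_le.
  apply/andP; split; first exact: len_low_sound.
  by apply: len_high_sound => //; rewrite addr_ge0.
Qed.

(** 157/50 s >= 29/8 + 7/10^4, and e^(29/8) is the power 16 of e^(29/128), for which
the fifth Taylor polynomial is precise. *)
Lemma exp_hexlen_ge : 1877 / 50 <= E.
Proof.
have sb := hexlen_bounds R.
apply: (@le_trans _ _ (expR (zr 29%BZ / zr 128%BZ) ^+ 16 * (1 + 7 / (100 * 100)))); last first.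
  apply: (@le_trans _ _ (expR (zr 29%BZ / zr 128%BZ) ^+ 16 * expR (7 / (100 * 100)))).
    by rewrite ler_pM2l ?exprn_gt0 ?expR_gt0 ?expR_ge1Dx.
  rewrite -expRM_natl -expRD ler_expR.
  by rewrite (@zr_nat R 29) (@zr_nat R 128); lra.
have e0 : 0 < zr (exp_num 29 128)%BZ / zr (exp_den 128)%BZ by rewrite divr_gt0 ?zr_gt0.
apply: (@le_trans _ _ ((zr (exp_num 29 128)%BZ / zr (exp_den 128)%BZ) ^+ 16 * (1 + 7 / (100 * 100)))); last first.
  rewrite ler_pM2r; last by lra.
  rewrite ler_pXn2r ?nnegrE ?expR_ge0 ?(ltW e0)//; exact: exp_ge_num.
have zX a n : zr a ^+ n = zr (a ^ Z.of_nat n)%BZ.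
  elim: n => [|n IH]; first by rewrite expr0 zr1.
  by rewrite exprS IH -zrM Nat2Z.inj_succ Z.pow_succ_r//; lia.
rewrite (_ : 1 + 7 / (100 * 100) = zr 10007%BZ / zr 10000%BZ); last first.
  rewrite -[10000%BZ]/(Z.of_nat 100 * Z.of_nat 100)%BZ -[10007%BZ]/(Z.of_nat 100 * Z.of_nat 100 + Z.of_nat 7)%BZ.
  by rewrite !zrD !zrM !zr_nat; field.
rewrite expr_div_n !zX mulrACA -invfM -!zrM.
rewrite (_ : 1877 / 50 = zr 1877%BZ / zr 50%BZ); last first.
  rewrite -[1877%BZ]/(Z.of_nat 18 * Z.of_nat 100 + Z.of_nat 77)%BZ -[50%BZ]/(Z.of_nat 50).
  by rewrite !zrD !zrM !zr_nat; field.
rewrite ler_pdivrMr ?zr_gt0// mulrAC ler_pdivlMr ?zr_gt0// -!zrM.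
apply: zr_le; exact/Z.leb_le.
Qed.
End CellsSound.

(** * Convex profiles *)

Section Profile.
Variable R : realType.
Local Notation s := (hexlen R).
Local Notation h := (@decay R).
Local Notation E := (expR (157 / 50 * s)).
Implicit Types (x c : R).

(** The last condition says that [psi] lies above its tangents, of relative slope
[- lam c] at [c]: it makes [psi] convex and, as [lam] is nonnegative, nonincreasing. *)
Definition profile (psi lam : R -> R) : Prop :=
  [/\ forall x, 0 < x -> 0 < psi x, psi s = 1, forall c, 0 < c -> 0 <= lam c
    & forall c x, 0 < c -> 0 < x -> psi c * (1 - lam c * (x - c)) <= psi x].

Variables psi lam : R -> R.
Hypothesis psiP : profile psi lam.

Lemma profile_bound x : 0 < x ->
  h x + lam s * (h x * (s - x)) <= h x * psi x.
Proof.
case: psiP => _ psi1 _ tangent x0.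
have := tangent s x (hexlen_gt0 R) x0; rewrite psi1 mul1r.
rewrite -(ler_pM2l (decay_gt0 x0)); apply: le_trans.
by rewrite le_eqVlt; apply/orP; left; apply/eqP; ring.
Qed.

Lemma profile_le1 x : s <= x -> psi x <= 1.
Proof.
case: psiP => psi0 psi1 lam0 tangent sx; have s0 := hexlen_gt0 R.
have x0 : 0 < x by exact: lt_le_trans sx.
have := tangent x s x0 s0; rewrite psi1; apply: le_trans.
rewrite ler_peMr ?(ltW (psi0 _ x0))// lerDl -mulrN opprB.
by rewrite mulr_ge0 ?lam0 ?subr_ge0.
Qed.

(** The tangent at c, evaluated at s where [psi] is 1.  This bounds the slope of
[psi] at c uniformly over all profiles. *)
Lemma profile_slope c : s < c -> lam c * psi c <= (c - s)^-1.
Proof.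
case: psiP => psi0 psi1 lam0 tangent sx; have s0 := hexlen_gt0 R.
have c0 : 0 < c by exact: lt_trans sx.
have := tangent c s c0 s0; rewrite psi1 -div1r ler_pdivlMr ?subr_gt0//.
have := psi0 _ c0; lra.
Qed.

(** The product of the tangents of [decay] and [psi]: both slopes are negative, so the
product of the two tangents exceeds its linear part. *)
Lemma profile_tangent c x : 3 * s <= c -> 100 / 157 <= x ->
  h c * psi c - h c * (157 / 50 * psi c - c^-1 * psi c + lam c * psi c) * (x - c) <= h x * psi x.
Proof.
case: psiP => psi0 psi1 lam0 tangent c3 x0; have s0 := hexlen_gt0 R.
have xp : 0 < x by lra.
have cp : 0 < c by lra.
have hx := decay_gt0 xp; have hc := decay_gt0 cp.
have t1 := decay_tangent c3 x0; have t2 := tangent c x cp xp.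
have sb := hexlen_bounds R.
have c3' : 3 <= c by lra.
have px := psi0 x xp; have pc := psi0 c cp; have lc := lam0 c cp.
set a := 157 / 50 - c^-1 in t1.
have a0 : 0 <= a.
  have : c^-1 <= 3^-1 by rewrite lef_pV2 ?posrE.
  by rewrite /a; lra.
rewrite (_ : _ - _ = (h c * psi c) * (1 - (a + lam c) * (x - c))); last by rewrite /a; ring.
have hp : 0 < h x * psi x by exact: mulr_gt0.
have [le0|gt0] := leP (1 - (a + lam c) * (x - c)) 0.
  by apply: le_trans (ltW hp); rewrite mulr_ge0_le0// mulr_ge0// ltW.
have prod_ge : 1 - (a + lam c) * (x - c) <= (1 - a * (x - c)) * (1 - lam c * (x - c)).
  have : 0 <= a * lam c * (x - c) ^+ 2 by rewrite mulr_ge0 ?sqr_ge0 ?mulr_ge0.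
  lra.
have [p1 p2] : 0 <= 1 - a * (x - c) /\ 0 <= 1 - lam c * (x - c).
  have [xc|/ltW cx] := leP x c.
    by split; rewrite subr_ge0 (le_trans _ ler01)// mulr_ge0_le0// subr_le0.
  have y0 : 0 <= x - c by rewrite subr_ge0.
  have := mulr_ge0 a0 y0; have := mulr_ge0 lc y0.
  by split; lra.
apply: (@le_trans _ _ ((h c * (1 - a * (x - c))) * (psi c * (1 - lam c * (x - c))))).
  rewrite mulrACA ler_wpM2l// mulr_ge0// ltW//.
by apply: ler_pM => //; rewrite mulr_ge0// ltW.
Qed.

(** Jensen's inequality for three points with mean c + dlt / 3.  The constant 18/5
bounds the slope of [decay * psi] at c relative to [decay c]: 157/50 from the
exponential, and at most 1 / (2 s) from [psi] by [profile_slope]. *)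
Lemma profile_triple c x y z dlt : 3 * s <= c ->
  100 / 157 <= x -> 100 / 157 <= y -> 100 / 157 <= z ->
  x + y + z = 3 * c + dlt -> 0 <= dlt ->
  3 * (h c * psi c) <= h x * psi x + h y * psi y + h z * psi z + h c * (18 / 5) * dlt.
Proof.
case: (psiP) => psi0 psi1 lam0 tangent c3 x0 y0 z0 sumE d0; have s0 := hexlen_gt0 R.
have := profile_tangent c3 x0; have := profile_tangent c3 y0; have := profile_tangent c3 z0.
have sc : s < c by lra.
have cp : 0 < c by lra.
have hc := decay_gt0 cp.
set m := _ - _ + _.
have m1 : m <= 18 / 5.
  have := profile_slope sc; have p1 := profile_le1 (ltW sc); have p0 := psi0 c cp.
  have : 0 <= c^-1 * psi c by rewrite mulr_ge0 ?invr_ge0 ?(ltW cp) ?(ltW p0).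
  have : (c - s)^-1 <= 46 / 100.
    have sb := hexlen_bounds R.
    have : (c - s)^-1 <= (23 / 10)^-1 by rewrite lef_pV2 ?posrE; lra.
    lra.
  rewrite /m; lra.
have : 0 <= (h c * dlt) * (18 / 5 - m) by rewrite mulr_ge0 ?mulr_ge0 ?subr_ge0 // ltW.
have -> : z = 3 * c + dlt - x - y by lra.
move: (h c * psi c) (h x * psi x) (h y * psi y) (h _ * psi _) (h c) => a1 a2 a3 a4 a5.
lra.
Qed.

Lemma decay_multiple n : h (n.+1%:R * s) = n.+1%:R * s * E ^- n.
Proof.
rewrite /decay -exprVn -expRN -expRM_natl; congr (_ * expR _).
by rewrite -natr1; ring.
Qed.

(** n.+3 ^ 2 <= 9 * 2 ^ n, and each further unit of the norm brings a factor below
1/36. *)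
Lemma decay_tail n : n.+3%:R * h (n.+3%:R * s) <= 9 * s * E ^- 2 * (1 / 18) ^+ n.
Proof.
rewrite decay_multiple.
have s0 := hexlen_gt0 R; have E0 : 0 < E by exact: expR_gt0.
have E2 : E^-1 <= 1 / 36.
  by rewrite div1r lef_pV2 ?posrE//; have := exp_hexlen_ge R; lra.
have n2 : (n.+3 ^ 2 <= 9 * 2 ^ n)%N.
  by elim: n => // n; rewrite (expnS 2 n) -!mulnn; nia.
have -> : E ^- n.+2 = (E^-1) ^+ n * E ^- 2 by rewrite -!exprVn -exprD addn2.
rewrite [leLHS](_ : _ = (n.+3 ^ 2)%:R * (E^-1) ^+ n * (s * E ^- 2)); last first.
  by rewrite natrX; ring.
rewrite [leRHS](_ : _ = 9 * (1/18)^+n * (s * E ^- 2)); last by ring.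
rewrite ler_pM2r ?mulr_gt0 ?invr_gt0 ?exprn_gt0//.
apply: (@le_trans _ _ ((9 * 2 ^+ n) * (1 / 36) ^+ n)).
  apply: ler_pM; [exact: ler0n|by rewrite exprn_ge0// invr_ge0 ltW| |].
    by rewrite -(natrX _ 2 n) -natrM ler_nat.
  by apply: lerXn2r => //; rewrite nnegrE ?invr_ge0 ?(ltW E0).
rewrite -mulrA -exprMn ler_pM2l//.
by rewrite (_ : 2 * (1 / 36) = 1 / 18); [|field].
Qed.

End Profile.

(** * Sums over countable sets *)

Section Sums.
Variable R : realType.
Local Open Scope ereal_scope.

Lemma esum_ge_seq (T : choiceType) (A : set T) (a : T -> \bar R) (l : seq T) :
  uniq l -> (forall x, x \in l -> A x) -> (forall x, A x -> 0 <= a x) ->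
  \sum_(x <- l) a x <= \esum_(x in A) a x.
Proof.
move=> ul lA a0; apply: esum_ge; exists [set` l].
  by split; [exact: finite_seq|move=> x /=; exact: lA].
by rewrite [leLHS]fsbig_seq.
Qed.

Lemma esum_seq (T : choiceType) (a : T -> \bar R) (l : seq T) :
  uniq l -> (forall x, x \in l -> 0 <= a x) ->
  \esum_(x in [set` l]) a x = \sum_(x <- l) a x.
Proof.
move=> ul a0; rewrite [RHS]fsbig_seq// esum_fset//.
by move=> i; rewrite inE /= => /a0.
Qed.

Lemma esumZl_le (T : choiceType) (A : set T) (a : T -> \bar R) (c : R) :
  (0 <= c)%R -> (forall x, A x -> 0 <= a x) ->
  \esum_(x in A) (c%:E * a x) <= c%:E * \esum_(x in A) a x.
Proof.
move=> c0 a0; apply: ge_ereal_sup => _ [X [finX XA] <-].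
apply: (@le_trans _ _ (c%:E * \sum_(x \in X) a x)).
  rewrite !fsbig_finite//= big_seq [in leRHS]big_seq ge0_sume_distrr//.
  by move=> x; rewrite in_fset_set// inE => /XA /a0.
rewrite lee_wpmul2l ?lee_fin//.
by apply: esum_ge; exists X.
Qed.

Lemma esum_nat_geometric (q : R) : (0 <= q < 1)%R ->
  \esum_(n in [set: nat]) (q ^+ n)%:E <= ((1 - q)^-1)%:E.
Proof.
move=> /andP[q0 q1]; have d0 : (0 < 1 - q)%R by rewrite subr_gt0.
rewrite -nneseries_esumT; last by move=> n; rewrite lee_fin exprn_ge0.
apply: lime_le; first by apply: is_cvg_nneseries => n _ _; rewrite lee_fin exprn_ge0.
near=> n; rewrite sumEFin lee_fin -[leRHS]div1r ler_pdivlMr// mulrC big_mkord.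
by rewrite -opprB mulNr -subrX1 opprB gerBl exprn_ge0.
Unshelve. all: by end_near. Qed.

(** The negative integers contribute less than the nonnegative ones. *)
Lemma esum_int_geometric (q : R) : (0 <= q < 1)%R ->
  \esum_(m in [set: int]) (q ^+ `|m|%N)%:E <= (2 / (1 - q))%:E.
Proof.
move=> qI; have q0 : (0 <= q)%R by case/andP: qI.
rewrite (esumID [set Posz n | n in [set: nat]]); last by move=> *; rewrite lee_fin exprn_ge0.
rewrite !setTI (_ : ~` _ = [set Negz n | n in [set: nat]]); last first.
  apply/seteqP; split => [[n|n] /=|_ [n _ <-] [m _]//].
    by move=> H; exfalso; apply: H; exists n.
  by move=> _; exists n.
rewrite !esum_image; [|by move=> i j _ _ []..].
rewrite mulr_natl mulr2n EFinD; apply: leeD; first exact: esum_nat_geometric.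
apply: le_trans (esum_nat_geometric qI); apply: le_esum => n _ /=.
by rewrite lee_fin exprS ler_piMl ?exprn_ge0//; case/andP: qI => _ /ltW.
Qed.

End Sums.

(** * The shells of the hexagonal lattice *)

Section HexNorm.
Implicit Types k : int * int.

(** The norm form of the Eisenstein integers. *)
Definition hexnorm k : nat := absz (k.1 * k.1 - k.1 * k.2 + k.2 * k.2).

Definition hex1 : seq (int * int) := [:: (1, 0); (0, 1); (1, 1); (-1, 0); (0, -1); (-1, -1)].
Definition hex3 : seq (int * int) := [:: (1, -1); (2, 1); (1, 2); (-1, 1); (-2, -1); (-1, -2)].
Definition hex4 : seq (int * int) := [:: (2, 0); (0, 2); (2, 2); (-2, 0); (0, -2); (-2, -2)].

Lemma hexnorm_small k : (`|k.1| <= 2)%N -> (`|k.2| <= 2)%N ->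
  [|| k == (0, 0), k \in hex1, k \in hex3, k \in hex4 | (7 <= hexnorm k)%N].
Proof.
move=> k1 k2.
pose rng : seq int := [:: -2; -1; 0; 1; 2].
have kin : k \in [seq (i, j) | i <- rng, j <- rng].
  have small (m : int) : (`|m| <= 2)%N -> m \in rng.
    by case: m => [[|[|[|m]]]|[|[|m]]].
  by apply/allpairsP; exists k; split; [exact: small|exact: small|case: k {k1 k2}].
move: k kin {k1 k2}; apply/allP; by vm_compute.
Qed.

Lemma hexnormE k : (hexnorm k)%:Z = k.1 * k.1 - k.1 * k.2 + k.2 * k.2.
Proof.
rewrite /hexnorm gez0_abs//; case: k => m n /=.
have := sqr_ge0 (2 * m - n); have := sqr_ge0 n; lia.
Qed.

Lemma hexnorm_ge_abs k : (3 * `|k.1| ^ 2 <= 4 * hexnorm k)%N /\ (3 * `|k.2| ^ 2 <= 4 * hexnorm k)%N.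
Proof.
have := hexnormE k; case: k => m n /=; rewrite -!mulnn => E1.
have := sqr_ge0 (2 * m - n); have := sqr_ge0 (m - 2 * n); rewrite !expr2.
by split; nia.
Qed.

Lemma hexnorm_large k : (3 <= maxn `|k.1| `|k.2|)%N -> (7 <= hexnorm k)%N.
Proof.
have [h1 h2] := hexnorm_ge_abs k; move: h1 h2; rewrite -!mulnn.
rewrite leq_max; nia.
Qed.

(** The norms 2, 5 and 6 are not represented. *)
Lemma hexnorm_cases k :
  [|| k == (0, 0), k \in hex1, k \in hex3, k \in hex4 | (7 <= hexnorm k)%N].
Proof.
have [large|small] := leqP 3 (maxn `|k.1| `|k.2|).
  by rewrite (hexnorm_large large) !orbT.
by apply: hexnorm_small; move: small; rewrite ltnS geq_max => /andP[].
Qed.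

Lemma hexnorm1 k : k \in hex1 -> hexnorm k = 1%N.
Proof. by move=> kin; apply/eqP; move: k kin; apply/allP; vm_compute. Qed.
Lemma hexnorm3 k : k \in hex3 -> hexnorm k = 3%N.
Proof. by move=> kin; apply/eqP; move: k kin; apply/allP; vm_compute. Qed.
Lemma hexnorm4 k : k \in hex4 -> hexnorm k = 4%N.
Proof. by move=> kin; apply/eqP; move: k kin; apply/allP; vm_compute. Qed.

Lemma hexnorm_growth k : (7 <= hexnorm k)%N -> (`|k.1| + `|k.2| + 3 <= 2 * (hexnorm k - 3))%N.
Proof.
have := hexnormE k; case: k => m n /=; move: (hexnorm _) => N E1 N7.
have N4 : ((`|m| + `|n|) * (`|m| + `|n|) <= 4 * N)%N.
  have := sqr_ge0 (m - n); have := sqr_ge0 (m + n); rewrite !expr2; nia.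
by nia.
Qed.

End HexNorm.

Section TailSum.
Variable R : realType.
Local Open Scope ereal_scope.

Definition hextail : set (int * int) := [set k | (3 <= hexnorm k)%N].

Lemma esum_subset (T : choiceType) (A B : set T) (a : T -> \bar R) :
  A `<=` B -> (forall x, B x -> 0 <= a x) -> \esum_(x in A) a x <= \esum_(x in B) a x.
Proof.
move=> AB a0; rewrite esum_mkcond [leRHS]esum_mkcond; apply: le_esum => x _.
case: ifPn => [/set_mem/AB/mem_set -> //|_]; case: ifPn => // /set_mem; exact: a0.
Qed.

Lemma esum_indic_seq (T : choiceType) (A : set T) (l : seq T) (c : R) :
  (0 <= c)%R -> uniq l -> 
  \esum_(x in A) (if x \in l then c%:E else 0) <= (c *+ size l)%:E.
Proof.
move=> c0 ul; apply: (@le_trans _ _ (\esum_(x in [set: T]) (if x \in [set` l] then c%:E else 0))).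
  apply: le_trans (esum_subset (@subsetT _ A) _) _.
    by move=> x _; case: ifP; rewrite ?lee_fin.
  by apply: le_esum => x _; rewrite mem_setE.
rewrite -esum_mkcond esum_seq//.
by rewrite sumEFin lee_fin big_const_seq count_predT iter_addr_0.
Qed.

Lemma esum_plane_geometric (q : R) : (0 <= q < 1)%R ->
  \esum_(k in [set: int * int]) (q ^+ `|k.1|%N * q ^+ `|k.2|%N)%:E <= ((2 / (1 - q)) ^+ 2)%:E.
Proof.
move=> qI; have /andP[q0 q1] := qI; have d0 : (0 < 1 - q)%R by rewrite subr_gt0.
have := @esum_esum R int int setT (fun=> setT) (fun m n => (q ^+ `|m|%N * q ^+ `|n|%N)%:E).
rewrite (_ : setT `*`` _ = setT); last by apply/seteqP; split.
move=> <-; last by move=> *; rewrite lee_fin mulr_ge0 ?exprn_ge0.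
set c := (2 / (1 - q))%R.
have c0 : (0 <= c)%R by rewrite divr_ge0 ?ltW.
apply: (@le_trans _ _ (\esum_(m in [set: int]) (c%:E * (q ^+ `|m|%N)%:E))).
  apply: le_esum => m _; under eq_esum do rewrite EFinM.
  apply: le_trans (esumZl_le _ _) _; rewrite ?exprn_ge0//.
    by move=> n _; rewrite lee_fin exprn_ge0.
  rewrite muleC lee_wpmul2r ?lee_fin ?exprn_ge0//; exact: esum_int_geometric.
apply: le_trans (esumZl_le c0 _) _; first by move=> n _; rewrite lee_fin exprn_ge0.
rewrite (_ : (c ^+ 2)%:E = c%:E * c%:E); last by rewrite -EFinM expr2.
by rewrite lee_wpmul2l ?lee_fin//; exact: esum_int_geometric.
Qed.

(** The norms 3 and 4 contribute 6 + 6/18.  From norm 7 on, [hexnorm_growth] and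
1/18 <= (1/4)^2 bound the terms by a double geometric series in |m| and |n|. *)
Lemma hextail_sum :
  \esum_(k in hextail) ((1 / 18) ^+ (hexnorm k - 3))%:E <= (13 / 2 : R)%:E.
Proof.
pose a k : \bar R := if k \in hex3 then 1%:E else 0.
pose b k : \bar R := if k \in hex4 then (1 / 18)%:E else 0.
pose c k : \bar R := (1 / 64)%:E * ((1 / 4) ^+ `|k.1|%N * (1 / 4) ^+ `|k.2|%N)%:E.
have a0 k : 0 <= a k by rewrite /a; case: ifP; rewrite ?lee_fin.
have b0 k : 0 <= b k by rewrite /b; case: ifP; rewrite ?lee_fin ?divr_ge0.
have c0 k : 0 <= c k by rewrite /c -EFinM lee_fin !mulr_ge0 ?exprn_ge0 ?invr_ge0.
apply: (@le_trans _ _ (\esum_(k in hextail) (a k + b k + c k))).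
  apply: le_esum => k k3; have := hexnorm_cases k; case/or4P => [/eqP k0|k1|k3'|].
  - by move: k3; rewrite k0.
  - by move: k3; rewrite /hextail /= (hexnorm1 k1).
  - rewrite (hexnorm3 k3') expr0 /a k3' -addeA leeDl// adde_ge0//.
  - move=> /orP[k4|k7].
      by rewrite (hexnorm4 k4) expr1 /b k4 addeAC leeDr// adde_ge0.
    apply: (@le_trans _ _ (c k)); last by rewrite leeDr// adde_ge0.
    rewrite /c -EFinM lee_fin -exprD.
    apply: (@le_trans _ _ ((1 / 4) ^+ (2 * (hexnorm k - 3)))%R).
      rewrite exprM; apply: lerXn2r; rewrite ?nnegrE; lra.
    rewrite (_ : 1 / 64 = (1 / 4) ^+ 3 :> R)%R; last by field.
    rewrite -exprD addnC; apply: ler_wiXn2l; [lra|lra|].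
    by rewrite hexnorm_growth.
rewrite !esumD//; last by move=> k _; rewrite adde_ge0.
rewrite (_ : 13 / 2 = 6 + 1 / 18 *+ 6 + (1 / 6) :> R)%R; last by field.
rewrite !EFinD; apply: leeD; first apply: leeD.
- by apply: le_trans (esum_indic_seq _ (l := hex3) _ _) _.
- by apply: le_trans (esum_indic_seq _ (l := hex4) _ _) _; rewrite ?divr_ge0.
apply: le_trans (esumZl_le _ _) _; rewrite ?divr_ge0//.
apply: (@le_trans _ _ ((1 / 64)%:E * ((2 / (1 - 1 / 4)) ^+ 2)%:E)); last first.
  rewrite -EFinM lee_fin (_ : 2 / (1 - 1 / 4) = 8 / 3)%R; last by field.
  lra.
rewrite lee_wpmul2l ?lee_fin ?divr_ge0//.
apply: le_trans (esum_plane_geometric _); last by apply/andP; split; lra.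
by apply: esum_subset => // k _; rewrite lee_fin mulr_ge0 ?exprn_ge0.
Qed.

End TailSum.

(** * Reduced quadratic forms of determinant one *)

Section Forms.
Variable R : realType.
Local Notation s := (hexlen R).
Local Notation h := (@decay R).
Local Notation E := (expR (157 / 50 * s)).
Implicit Types (p q t : R) (k : int * int).

(** The sign of t makes (1, 1) a short vector when t is positive. *)
Definition qform p q t k : R :=
  p * k.1%:~R ^+ 2 - 2 * t * (k.1%:~R * k.2%:~R) + q * k.2%:~R ^+ 2.

Definition reduced p q t : Prop :=
  [/\ 0 <= 2 * t <= p, p <= q & p * q - t ^+ 2 = 1].

Definition nonzero : set (int * int) := [set k | k != (0, 0)].

Lemma qform_hex k : qform s s (s / 2) k = (hexnorm k)%:R * s.
Proof.
have -> : (hexnorm k)%:R = (hexnorm k)%:Z%:~R :> R by [].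
by rewrite hexnormE /qform !rmorphD rmorphN !rmorphM /=; field.
Qed.

Lemma hexnorm_gt0 k : nonzero k -> (0 < hexnorm k)%N.
Proof.
move=> k0; have := hexnorm_cases k; case/orP => [/eqP k00|]; first by move: k0; rewrite /nonzero /= k00.
case/or4P => [/hexnorm1 ->|/hexnorm3 ->|/hexnorm4 ->|]//; exact: leq_trans.
Qed.

Lemma reduced_gt0 p q t : reduced p q t -> 0 < p.
Proof. case=> /andP[t0 tp] pq H; nra. Qed.

(** For m n >= 0 the form is at least p times the norm [hexnorm]; for m n < 0 it is at
least p (m^2 + n^2). *)
Lemma qform_ge p q t k : reduced p q t -> nonzero k -> p <= qform p q t k.
Proof.
move=> red k0; have p0 := reduced_gt0 red; case: red => /andP[t0 tp] pq _.
have N1 := hexnorm_gt0 k0; rewrite /qform.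
have sq_ge1 : 1 <= k.1%:~R ^+ 2 + k.2%:~R ^+ 2 :> R.
  rewrite (_ : _ + _ = (k.1 * k.1 + k.2 * k.2)%:~R); last by rewrite rmorphD !rmorphM !expr2.
  rewrite ler1z; move: k0; case: k {N1} => m n; rewrite /nonzero /= xpair_eqE negb_and; nia.
have NE : k.1%:~R ^+ 2 - k.1%:~R * k.2%:~R + k.2%:~R ^+ 2 = (hexnorm k)%:R :> R.
  have -> : (hexnorm k)%:R = (hexnorm k)%:Z%:~R :> R by [].
  by rewrite hexnormE !rmorphD rmorphN !rmorphM /= !expr2.
have {}N1 : 1 <= (hexnorm k)%:R :> R by rewrite ler1n.
rewrite -NE in N1; move: (k.1%:~R : R) (k.2%:~R : R) sq_ge1 N1 => m n sq1 N1 {NE}.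
have n2 : 0 <= (q - p) * n ^+ 2 by rewrite mulr_ge0 ?sqr_ge0 ?subr_ge0.
have [mn|mn] := leP 0 (m * n).
  have : 0 <= (p - 2 * t) * (m * n) by rewrite mulr_ge0 ?subr_ge0.
  have : 0 <= p * (m ^+ 2 - m * n + n ^+ 2 - 1) by rewrite mulr_ge0 ?subr_ge0 // ltW.
  lra.
have : 0 <= (2 * t) * (- (m * n)) by rewrite mulr_ge0// oppr_ge0 ltW.
have : 0 <= p * (m ^+ 2 + n ^+ 2 - 1) by rewrite mulr_ge0 ?subr_ge0 // ltW.
lra.
Qed.

Lemma qform_gt0 p q t k : reduced p q t -> nonzero k -> 0 < qform p q t k.
Proof. move=> red k0; exact: lt_le_trans (reduced_gt0 red) (qform_ge red k0). Qed.

Lemma reduced_hex : reduced s s (s / 2).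
Proof.
have := hexlen_gt0 R; have := hexlen2 R; rewrite /reduced.
by move: (hexlen R) => x x2 x0; split; lra.
Qed.

(** 1877/50 is the lower bound [exp_hexlen_ge] of the normalising factor. *)
Lemma decay_ge (x : R) (e : R) : 0 <= x -> e <= expR (- (157 / 50 * x)) -> 0 <= e ->
  x * e * (1877 / 50) <= h x.
Proof.
move=> x0 ee e0; rewrite decayE; apply: ler_pM; [exact: mulr_ge0|lra|exact: ler_wpM2l|exact: exp_hexlen_ge].
Qed.

Lemma decay_window x : 3 / 20 <= x <= 1 / 2 -> 7 / 2 <= h x.
Proof.
move=> /andP[x1 x2]; have [xb|xb] := leP x (50 / 157).
  apply: le_trans (decay_incr _ x1 xb); last by lra.
  apply: le_trans (@decay_ge (3 / 20) (62 / 100 + 25 / (100 * 100)) _ _ _); [lra|lra| |lra].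
  apply: le_trans (exp_ge5 _); lra.
apply: le_trans (decay_anti (ltW xb) x2).
apply: le_trans (@decay_ge (1 / 2) (19 / 100) _ _ _); [lra|lra| |lra].
by apply: le_trans (exp_ge5 _); lra.
Qed.

Lemma decay_window_wide x : 3 / 20 <= x <= 3 / 5 -> 23 / 10 <= h x.
Proof.
move=> /andP[x1 x2]; have [xb|xb] := leP x (50 / 157).
  by have := @decay_window x _; rewrite x1 /=; lra.
apply: le_trans (decay_anti (ltW xb) x2).
apply: le_trans (@decay_ge (3 / 5) (103 / 1000) _ _ _); [lra|lra| |lra].
by apply: le_trans (exp_ge5 _); lra.
Qed.

Lemma decay_window_low x : 3 / 80 <= x <= 3 / 20 -> 6 / 5 <= h x.
Proof.
move=> /andP[x1 x2]; apply: le_trans (decay_incr _ x1 _); [|lra|lra].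
apply: le_trans (@decay_ge (3 / 80) (88 / 100) _ _ _); [lra|lra| |lra].
by apply: le_trans (exp_ge5 _); lra.
Qed.

(** An upper bound for half the energy of the hexagonal lattice, see
[hex_energy_le]: the shortest vectors give 3 s, and 39/4 is half of 3 * 13/2, from
[decay_tail] and [hextail_sum]. *)
Definition hex_bound : R := 3 * s + 39 / 4 * (s * E ^- 2).

Lemma hex_bound_le : hex_bound <= (3472 / 1000 + 29 / (1000 * 100)).
Proof.
have sb := hexlen_bounds R; have Eb := exp_hexlen_ge R.
have Ei : E ^- 2 <= (7096 / (1000 * 1000 * 10)).
  apply: (@le_trans _ _ ((1877 / 50) ^- 2)); last by lra.
  have c0 : 0 < 1877 / 50 :> R by lra.
  rewrite lef_pV2 ?posrE; [|exact: exprn_gt0 (expR_gt0 _)|exact: exprn_gt0].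
  by apply: lerXn2r Eb; rewrite nnegrE ltW// expR_gt0.
have E0 : 0 <= E ^- 2 by rewrite invr_ge0 exprn_ge0 ?expR_ge0.
rewrite /hex_bound; move: (s) (E ^- 2) sb Ei E0 {Eb} => t i tb ib i0.
have : 0 <= i * (97 / 84 - t) by apply: mulr_ge0; lra.
lra.
Qed.

Lemma hex_bound_lt : hex_bound < 7 / 2.
Proof. by apply: le_lt_trans hex_bound_le _; lra. Qed.

Lemma hex_bound_le_far : hex_bound <= 37 / 400 * E.
Proof. by apply: le_trans hex_bound_le _; have := exp_hexlen_ge R; lra. Qed.

End Forms.

(** * Energies of reduced forms *)

Section Planar.
Variable R : realType.
Local Notation s := (hexlen R).
Local Notation h := (@decay R).
Local Notation E := (expR (157 / 50 * s)).
Variables psi lam : R -> R.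
Hypothesis psiP : profile psi lam.
Implicit Types (p q t : R) (k : int * int).

Let J (x : R) : R := h x * psi x.

Definition form_energy p q t : \bar R :=
  \esum_(k in nonzero) (J (qform p q t k))%:E.
Local Notation F := form_energy.

Let J_gt0 x : 0 < x -> 0 < J x.
Proof. by case: psiP => psi0 _ _ _ x0; rewrite mulr_gt0 ?decay_gt0 ?psi0. Qed.

Let JE_ge0 p q t k : reduced p q t -> nonzero k -> (0 <= (J (qform p q t k))%:E)%E.
Proof. by move=> red k0; rewrite lee_fin ltW// J_gt0// qform_gt0. Qed.

(** The profile has disappeared from the lower bound: its tangent at s has an unknown
slope, which multiplies a nonnegative sum. *)
Lemma finite_lower_bound p q t (l : seq (int * int)) : reduced p q t ->
  uniq l -> (forall k, k \in l -> nonzero k) ->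
  0 <= \sum_(k <- l) h (qform p q t k) * (s - qform p q t k) ->
  ((\sum_(k <- l) h (qform p q t k))%:E <= F p q t)%E.
Proof.
move=> red ul lnz slope.
apply: le_trans (esum_ge_seq ul lnz (fun k => @JE_ge0 p q t k red)).
rewrite sumEFin lee_fin.
apply: (@le_trans _ _ (\sum_(k <- l) (h (qform p q t k) + lam s * (h (qform p q t k) * (s - qform p q t k))))).
  rewrite big_split /= -mulr_sumr lerDl mulr_ge0//.
  by case: psiP => _ _ lam0 _; exact/lam0/hexlen_gt0.
rewrite big_seq [leRHS]big_seq; apply: ler_sum => k kl.
exact: profile_bound (qform_gt0 red (lnz k kl)).
Qed.

Lemma hextail_nonzero : hextail `<=` nonzero.
Proof. by move=> k; rewrite /hextail /nonzero /=; apply: contraTneq => ->. Qed.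

Lemma nonzero_split : nonzero = [set` hex1] `|` hextail.
Proof.
apply/seteqP; split => k /=; last first.
  case; last exact: hextail_nonzero.
  by apply: contraTneq => ->.
move=> k0; have := hexnorm_cases k; rewrite /nonzero /= in k0.
rewrite (negbTE k0) /= => /or4P[k1|k3|k4|k7]; [by left|right..].
- by rewrite /hextail /= (hexnorm3 k3).
- by rewrite /hextail /= (hexnorm4 k4).
- exact: leq_trans k7.
Qed.

Lemma form_energy_split p q t : reduced p q t ->
  F p q t = (2 * (J p + J q + J (p + q - 2 * t)))%:E +
    \esum_(k in hextail) (J (qform p q t k))%:E :> \bar R.
Proof.
move=> red; rewrite /form_energy (esumID [set` hex1]); last by move=> k; exact: JE_ge0.
congr (_ + _)%E.
  rewrite nonzero_split setIUl setIid (_ : hextail `&` _ = set0) ?setU0; last first.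
    apply/seteqP; split => // k [] /= + k1; rewrite /hextail /= (hexnorm1 k1)//.
  rewrite esum_seq//; last first.
    move=> k kl; apply: JE_ge0 => //; rewrite nonzero_split; by left.
  rewrite /hex1 !big_cons big_nil adde0 -!EFinD; congr EFin.
  have -> : qform p q t (1, 0) = p by rewrite /qform /=; ring.
  have -> : qform p q t (0, 1) = q by rewrite /qform /=; ring.
  have -> : qform p q t (1, 1) = p + q - 2 * t by rewrite /qform /=; ring.
  have -> : qform p q t (-1, 0) = p by rewrite /qform /=; ring.
  have -> : qform p q t (0, -1) = q by rewrite /qform /=; ring.
  have -> : qform p q t (-1, -1) = p + q - 2 * t by rewrite /qform /=; ring.
  ring.
congr esum; rewrite nonzero_split setIUl setICr set0U.
apply/seteqP; split => [k []//|k kt]; split => //= k1.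
by move: kt; rewrite /hextail /= (hexnorm1 k1).
Qed.

Lemma hextail_energy :
  (\esum_(k in hextail) ((hexnorm k)%:R * h ((hexnorm k)%:R * s))%:E
    <= (117 / 2 * (s * E ^- 2))%:E)%E.
Proof.
have c0 : 0 <= 9 * s * E ^- 2.
  by rewrite mulr_ge0 ?invr_ge0 ?exprn_ge0 ?expR_ge0// mulr_ge0// ltW// hexlen_gt0.
apply: (@le_trans _ _ (\esum_(k in hextail) ((9 * s * E ^- 2)%:E * ((1 / 18) ^+ (hexnorm k - 3))%:E))%E).
  apply: le_esum => k; rewrite /hextail /= -EFinM lee_fin => k3.
  have := decay_tail R (hexnorm k - 3); rewrite -addn3 subnK//.
apply: le_trans (esumZl_le c0 _) _; first by move=> k _; rewrite lee_fin exprn_ge0// divr_ge0.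
apply: le_trans (lee_wpmul2l _ (hextail_sum R)) _; first by rewrite lee_fin.
by rewrite -EFinM lee_fin; move: (E ^- 2) => e; lra.
Qed.

Lemma hex_tail_bound :
  (\esum_(k in hextail) (J (qform s s (s / 2) k))%:E <= (39 / 2 * (s * E ^- 2))%:E)%E.
Proof.
apply: (@le_trans _ _ (\esum_(k in hextail) ((1 / 3)%:E * ((hexnorm k)%:R * h ((hexnorm k)%:R * s))%:E))%E).
  apply: le_esum => k; rewrite /hextail /= -EFinM lee_fin qform_hex => k3.
  have N3 : 3 <= (hexnorm k)%:R :> R by rewrite ler_nat.
  have s0 := hexlen_gt0 R.
  have x0 : 0 < (hexnorm k)%:R * s by rewrite mulr_gt0//; lra.
  have hx := decay_gt0 x0.
  apply: (@le_trans _ _ (h ((hexnorm k)%:R * s))).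
    rewrite ger_pMr//; apply: profile_le1 psiP _ _.
    by rewrite ler_peMl ?(ltW s0)//; lra.
  have : 0 <= ((hexnorm k)%:R - 3) * h ((hexnorm k)%:R * s).
    by rewrite mulr_ge0 ?subr_ge0 ?(ltW hx).
  move: (h _) => y; lra.
apply: le_trans (esumZl_le _ _) _; first by rewrite divr_ge0.
  move=> k _; rewrite lee_fin mulr_ge0//.
  case: (posnP (hexnorm k)) => [->|N0]; first by rewrite mul0r /decay mul0r.
  by rewrite ltW// decay_gt0// mulr_gt0 ?hexlen_gt0// ltr0n.
apply: le_trans (lee_wpmul2l _ hextail_energy) _; first by rewrite lee_fin divr_ge0.
by rewrite -EFinM lee_fin; lra.
Qed.

Lemma psi_hexlen : psi s = 1. Proof. by case: psiP. Qed.

Lemma hex_energy_le : (F s s (s / 2) <= (2 * hex_bound R)%:E)%E.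
Proof.
rewrite form_energy_split; last exact: reduced_hex.
rewrite (_ : 2 * hex_bound R = 2 * (J s + J s + J (s + s - 2 * (s / 2))) + 39 / 2 * (s * E ^- 2)).
  by rewrite EFinD leeD2l// hex_tail_bound.
have -> : s + s - 2 * (s / 2) = s by field.
by rewrite /J decay_hexlen psi_hexlen /hex_bound; lra.
Qed.

(** The rotation e1 -> e2 -> - (e1 + e2) in coordinates.  Over its orbits the form only
depends on the norm and on p + q + r, see [qform_rot_sum]. *)
Definition rot k : int * int := (- k.2, k.1 - k.2).

Lemma hexnorm_rot k : hexnorm (rot k) = hexnorm k.
Proof. rewrite /hexnorm /rot /=; congr absz; ring. Qed.

Lemma rot_bij : set_bij hextail hextail rot.
Proof.
split.
- by move=> k; rewrite /hextail /= hexnorm_rot.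
- move=> [m n] [m' n'] _ _ [] /oppr_inj -> /eqP.
  by rewrite (inj_eq (addIr _)) => /eqP ->.
- move=> k kt; exists (k.2 - k.1, - k.1).
    rewrite /hextail /= (_ : hexnorm _ = hexnorm k)//.
    rewrite /hexnorm /=; congr absz; ring.
  by rewrite /rot /=; case: k {kt} => m n /=; congr (_, _); ring.
Qed.

Lemma qform_rot_sum p q t k :
  qform p q t k + qform p q t (rot k) + qform p q t (rot (rot k)) =
  (hexnorm k)%:R * (p + q + (p + q - 2 * t)).
Proof.
have -> : (hexnorm k)%:R = (hexnorm k)%:Z%:~R :> R by [].
rewrite hexnormE /qform /rot /=; ring.
Qed.

Definition tail_energy p q t : \bar R :=
  \esum_(k in hextail) (J (qform p q t k))%:E.

(** [profile_triple] on every orbit of [rot], around the hexagonal squared length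
N s: the deviations from it add up to N times the excess p + q + r - 3 s.  The sum of
the tail appears three times, once for each place in the orbits. *)
Lemma tail_comparison p q t : reduced p q t -> 100 / 157 <= p ->
  0 <= p + q + (p + q - 2 * t) - 3 * s ->
  (tail_energy s s (s / 2) + tail_energy s s (s / 2) + tail_energy s s (s / 2) <=
   tail_energy p q t + tail_energy p q t + tail_energy p q t +
    (18 / 5 * (p + q + (p + q - 2 * t) - 3 * s) * (117 / 2 * (s * E ^- 2)))%:E)%E.
Proof.
move=> red p1 S0; set Th := tail_energy s s _; set Tl := tail_energy p q t.
set S := _ - 3 * s in S0 *.
have J0 p' q' t' k : reduced p' q' t' -> hextail k -> (0 <= (J (qform p' q' t' k))%:E)%E.
  by move=> red' /hextail_nonzero; exact: JE_ge0.
have Tl1 : Tl = (\esum_(k in hextail) (J (qform p q t (rot k)))%:E)%E.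
  exact: (reindex_esum hextail hextail rot _ rot_bij).
have Tl2 : Tl = (\esum_(k in hextail) (J (qform p q t (rot (rot k))))%:E)%E.
  rewrite Tl1; exact: (reindex_esum hextail hextail rot (fun k => (J (qform p q t (rot k)))%:E) rot_bij).
have rotP k : hextail k -> hextail (rot k) by rewrite /hextail /= hexnorm_rot.
have c0 : 0 <= 18 / 5 * S by rewrite mulr_ge0// divr_ge0.
have hN k : (0 <= ((hexnorm k)%:R * h ((hexnorm k)%:R * s))%:E)%E.
  rewrite lee_fin mulr_ge0//.
  case: (posnP (hexnorm k)) => [->|N0]; first by rewrite mul0r /decay mul0r.
  by rewrite ltW// decay_gt0// mulr_gt0 ?hexlen_gt0// ltr0n.
apply: (@le_trans _ _ (\esum_(k in hextail) ((J (qform p q t k))%:E + (J (qform p q t (rot k)))%:E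
   + (J (qform p q t (rot (rot k))))%:E +
   (18 / 5 * S)%:E * ((hexnorm k)%:R * h ((hexnorm k)%:R * s))%:E))%E).
  rewrite /Th /tail_energy -!esumD//; do ?[by move=> k kt; rewrite ?adde_ge0// J0//; exact: reduced_hex].
  apply: le_esum => k kt; rewrite -EFinM -!EFinD lee_fin qform_hex.
  have N3 : 3 <= (hexnorm k)%:R :> R by rewrite ler_nat.
  have s0 := hexlen_gt0 R.
  have form_le k' : hextail k' -> 100 / 157 <= qform p q t k'.
    by move=> k't; apply: le_trans p1 _; apply: qform_ge => //; exact: hextail_nonzero.
  have := @profile_triple _ _ _ psiP ((hexnorm k)%:R * s) (qform p q t k) (qform p q t (rot k))
    (qform p q t (rot (rot k))) ((hexnorm k)%:R * S) _ (form_le _ kt) (form_le _ (rotP _ kt))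
    (form_le _ (rotP _ (rotP _ kt))) _ _.
  rewrite ler_pM2r// qform_rot_sum => /(_ N3) H.
  have sumE : (hexnorm k)%:R * (p + q + (p + q - 2 * t)) = 3 * ((hexnorm k)%:R * s) + (hexnorm k)%:R * S.
    by rewrite /S; ring.
  have dlt0 : 0 <= (hexnorm k)%:R * S by rewrite mulr_ge0//; lra.
  move: (H sumE dlt0); rewrite /J.
  move: (h _) (h _ * psi _) (h _ * psi _) (h _ * psi _) => y y1 y2 y3; move: (_ * psi _) => y4.
  by move: ((hexnorm k)%:R) => N; lra.
have f0 k (kt : hextail k) := J0 _ _ _ _ red kt.
have f1 k (kt : hextail k) := J0 _ _ _ _ red (rotP _ kt).
have f2 k (kt : hextail k) := J0 _ _ _ _ red (rotP _ (rotP _ kt)).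
rewrite esumD => [|k kt|k _]; last 2 first.
- by apply: adde_ge0; [apply: adde_ge0; [exact: f0|exact: f1]|exact: f2].
- by apply: mule_ge0; [rewrite lee_fin|exact: hN].
rewrite esumD => [|k kt|k kt]; last 2 first.
- by apply: adde_ge0; [exact: f0|exact: f1].
- exact: f2.
rewrite esumD => [|k kt|k kt]; last 2 first.
- exact: f0.
- exact: f1.
rewrite -Tl1 -Tl2 leeD2l//.
apply: le_trans (esumZl_le c0 _) _; first by move=> k _; exact: hN.
by rewrite [leRHS]EFinM lee_wpmul2l ?lee_fin// hextail_energy.
Qed.

(** The gain is at least 7/100 times the excess by [near_value], and the loss in the
tail at most 6/5 * 117/2 * 9/10^4 times the excess. *)
Lemma near_energy p q t : reduced p q t -> p + q - 2 * t <= 137 / 100 ->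
  3 * s < p + q + (p + q - 2 * t) -> (F s s (s / 2) < F p q t)%E.
Proof.
move=> red r1 S0; have p0 := reduced_gt0 red.
case: (red) => /andP[t0 tp] pq det.
have qr : q <= p + q - 2 * t by lra.
have p1 : 7 / 10 <= p.
  rewrite leNgt; apply/negP => p7.
  have : p * q <= 7 / 10 * (137 / 100) by apply: ler_pM; lra.
  have := sqr_ge0 t; lra.
have heron : 2 * (p * q + q * (p + q - 2 * t) + (p + q - 2 * t) * p)
   - (p ^+ 2 + q ^+ 2 + (p + q - 2 * t) ^+ 2) = 4.
  by lra.
have pI : 7 / 10 <= p <= 137 / 100 by apply/andP; split; lra.
have qI : 7 / 10 <= q <= 137 / 100 by apply/andP; split; lra.
have rI : 7 / 10 <= p + q - 2 * t <= 137 / 100 by apply/andP; split; lra.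
have value := near_value pI qI rI heron; have slope := near_slope pI qI rI heron.
have p157 : 100 / 157 <= p by lra.
have S1 : 0 <= p + q + (p + q - 2 * t) - 3 * s by rewrite subr_ge0 ltW.
have tail := tail_comparison red p157 S1.
rewrite (form_energy_split red) (form_energy_split (reduced_hex R)).
rewrite -/(tail_energy p q t) -/(tail_energy s s (s / 2)).
have Tl0 : (0 <= tail_energy p q t)%E.
  by apply: esum_ge0 => k kt; apply: JE_ge0 => //; exact: hextail_nonzero.
have Th0 : (0 <= tail_energy s s (s / 2))%E.
  by apply: esum_ge0 => k kt; apply: JE_ge0 => //; [exact: reduced_hex|exact: hextail_nonzero].
have Thfin := le_lt_trans hex_tail_bound (ltry _).
rewrite -/(tail_energy s s (s / 2)) in Thfin.
move: Tl0 Th0 Thfin tail; case: (tail_energy s s _) => [y| |] //; case: (tail_energy p q t) => [x| |] //.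
  move=> _ _ _; rewrite -!EFinD !lee_fin lte_fin => tail.
  have -> : s + s - 2 * (s / 2) = s by field.
  have -> : J s = s by rewrite /J decay_hexlen psi_hexlen mulr1.
  have lam0 : 0 <= lam s by case: psiP => _ _ lam0 _; exact/lam0/hexlen_gt0.
  have b1 := profile_bound psiP p0.
  have b2 := profile_bound psiP (lt_le_trans p0 pq).
  have b3 := profile_bound psiP (lt_le_trans (lt_le_trans p0 pq) qr).
  have sl := mulr_ge0 lam0 slope.
  have gain : 3 * s + 7 / 200 * (p + q + (p + q - 2 * t) - 3 * s) <= J p + J q + J (p + q - 2 * t).
    rewrite /J; move: value sl b1 b2 b3; move: (h p) (h q) (h (p + q - 2 * t)) => hp hq hr.
    move: (lam s) => l; lra.
  have Eb : s * E ^- 2 <= 9 / (100 * 100).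
    have sb := hexlen_bounds R.
    have Ei := hex_bound_le R; rewrite /hex_bound in Ei; lra.
  have e1 : 0 <= (p + q + (p + q - 2 * t) - 3 * s) * (9 / (100 * 100) - s * E ^- 2).
    by apply: mulr_ge0; lra.
  move: (s * E ^- 2) Eb e1 tail gain => w; move: (J p) (J q) (J _) => jp jq jr.
  lra.
move=> _ _ _ _; exact: ltry.
Qed.

(** In the coordinates p and x = t / p, the squared lengths q, r and p + q + 2 t are
[len p x], [len p (1 - x)] and [len p (1 + x)]. *)
Lemma far_energy p q t : reduced p q t -> 1 / 2 <= p ->
  137 / 100 < p + q - 2 * t -> (F s s (s / 2) < F p q t)%E.
Proof.
move=> red p1 r1; have p0 := reduced_gt0 red.
case: (red) => /andP[t0 tp] pq det.
have pn0 : p != 0 by rewrite gt_eqF.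
pose x := t / p.
have qE : len p x = q.
  have pqE : p * q = 1 + t ^+ 2 by lra.
  by rewrite /len /x; apply: (mulfI pn0); rewrite pqE; field.
have rE : len p (1 - x) = p + q - 2 * t.
  by rewrite -qE /len /x; field.
have rrE : len p (1 + x) = p + q + 2 * t.
  by rewrite -qE /len /x; field.
have pI : 1 / 2 <= p <= 97 / 84.
  rewrite p1 /=; rewrite leNgt; apply/negP => p2.
  have : p ^+ 2 <= p * q by rewrite expr2 ler_pM2l.
  have : t ^+ 2 <= (p / 2) ^+ 2 by apply: lerXn2r; rewrite ?nnegrE; lra.
  have : (97 / 84) ^+ 2 < p ^+ 2 by rewrite ltr_pXn2r ?nnegrE//; lra.
  lra.
have xI : 0 <= x <= 1 / 2.
  by rewrite /x; apply/andP; split; [rewrite divr_ge0//; lra|rewrite ler_pdivrMr//; lra].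
have px : p <= len p x by rewrite qE.
have rx : 137 / 100 < len p (1 - x) by rewrite rE.
have value := far_value pI xI px rx; have slope := far_slope pI xI px rx.
rewrite qE rE rrE in value slope.
pose l : seq (int * int) := [:: (1, 0); (0, 1); (1, 1); (1, -1); (-1, 0); (0, -1); (-1, -1); (-1, 1)].
have lE (f : R -> R) : \sum_(k <- l) f (qform p q t k) =
    2 * (f p + f q + f (p + q - 2 * t) + f (p + q + 2 * t)).
  rewrite /l !big_cons big_nil.
  have -> : qform p q t (1, 0) = p by rewrite /qform /=; ring.
  have -> : qform p q t (0, 1) = q by rewrite /qform /=; ring.
  have -> : qform p q t (1, 1) = p + q - 2 * t by rewrite /qform /=; ring.
  have -> : qform p q t (1, -1) = p + q + 2 * t by rewrite /qform /=; ring.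
  have -> : qform p q t (-1, 0) = p by rewrite /qform /=; ring.
  have -> : qform p q t (0, -1) = q by rewrite /qform /=; ring.
  have -> : qform p q t (-1, -1) = p + q - 2 * t by rewrite /qform /=; ring.
  have -> : qform p q t (-1, 1) = p + q + 2 * t by rewrite /qform /=; ring.
  ring.
apply: le_lt_trans hex_energy_le _.
apply: (@lt_le_trans _ _ ((\sum_(k <- l) h (qform p q t k))%:E)).
  rewrite lte_fin (lE h) ltr_pM2l//.
  exact: le_lt_trans (hex_bound_le_far R) value.
apply: finite_lower_bound => //.
  by move=> k; rewrite /l !inE => /or4P[||| /or4P[|||/orP[]]] /eqP ->.
by rewrite (lE (fun y => h y * (s - y))) mulr_ge0.
Qed.

Lemma uniq_multiples n : (0 < n)%N ->
  uniq [:: Posz n; Posz n.+1; - Posz n; - Posz n.+1].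
Proof.
by move=> n0; rewrite /= !inE !negb_or; apply/and4P; split=> //; lia.
Qed.

(** The multiples of e1 that are used have squared length at most s, so their slope terms
are nonnegative.  If p is below 3/20, the least n + 1 with p (n + 1)^2 >= 3/20 has
p (n + 1)^2 <= 3/5 and p n^2 >= 3/80, and both multiples together suffice. *)
Lemma cusp_energy p q t : reduced p q t -> p < 1 / 2 -> (F s s (s / 2) < F p q t)%E.
Proof.
move=> red p1; have p0 := reduced_gt0 red.
have sb := hexlen_bounds R.
have mulE (n : int) : qform p q t (n, 0) = p * n%:~R ^+ 2 by rewrite /qform /=; ring.
have bound (l : seq int) : uniq l -> (0 : int) \notin l ->
    (forall n, n \in l -> p * n%:~R ^+ 2 <= s) ->
    2 * hex_bound R < \sum_(n <- l) h (p * n%:~R ^+ 2) -> (F s s (s / 2) < F p q t)%E.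
  move=> ul l0 ls big; apply: le_lt_trans hex_energy_le _.
  apply: (@lt_le_trans _ _ ((\sum_(k <- [seq (n, 0) | n <- l]) h (qform p q t k))%:E)).
    rewrite lte_fin big_map; apply: lt_le_trans big _.
    by under [leRHS]eq_bigr do rewrite mulE.
  have lnz n : n \in l -> nonzero (n, 0).
    by move=> nl; rewrite /nonzero /= xpair_eqE andbT; apply: contraNneq l0 => <-.
  apply: finite_lower_bound => //.
  - by rewrite map_inj_uniq// => m n [].
  - by move=> k /mapP[n nl ->]; exact: lnz.
  rewrite big_map big_seq; apply: sumr_ge0 => n nl; rewrite mulr_ge0//.
    by rewrite ltW// decay_gt0// qform_gt0//; exact: lnz.
  by rewrite mulE subr_ge0 ls.
have hb := hex_bound_lt R.
have [p2|p2] := leP (3 / 20) p.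
  apply: (bound [:: 1; -1]) => //.
    by move=> n; rewrite !inE => /orP[] /eqP ->; rewrite ?mulrN1z ?sqrrN expr1n mulr1; lra.
  rewrite !big_cons big_nil mulrN1z sqrrN expr1n mulr1.
  have : 7 / 2 <= h p by apply: decay_window; apply/andP; split; lra.
  lra.
have [n nP nmin] : exists2 n : nat, 3 / 20 <= p * n.+1%:R ^+ 2 & p * n%:R ^+ 2 < 3 / 20.
  have ex : exists n : nat, 3 / 20 <= p * n%:R ^+ 2.
    exists (Num.trunc (1 / p)).+1.
    have b1 : 1 / p < (Num.trunc (1 / p)).+1%:R by apply: truncnS_gt.
    have b2 : 1 < p * (Num.trunc (1 / p)).+1%:R by rewrite mulrC -ltr_pdivrMr.
    have b3 : 1 <= (Num.trunc (1 / p)).+1%:R :> R by rewrite ler1n.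
    rewrite expr2 mulrA; nra.
  case: (ex_minnP ex) => [[|n]] nP nmin; first by move: nP; rewrite expr0n mulr0; lra.
  exists n => //; rewrite ltNge; apply/negP => /nmin; by rewrite ltnn.
have n0 : (0 < n)%N.
  by case: n nP nmin => //; rewrite expr1n mulr1; lra.
have n1 : 1 <= n%:R :> R by rewrite ler1n.
have bb : p * n.+1%:R ^+ 2 <= 4 * (p * n%:R ^+ 2).
  have : 0 <= p * ((n%:R - 1) * (3 * n%:R + 1)).
    by rewrite mulr_ge0 ?(ltW p0)// mulr_ge0 ?subr_ge0//; lra.
  rewrite -natr1; lra.
have hb1 : 23 / 10 <= h (p * n.+1%:R ^+ 2) by apply: decay_window_wide; lra.
have ha1 : 6 / 5 <= h (p * n%:R ^+ 2) by apply: decay_window_low; lra.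
apply: (bound [:: Posz n; Posz n.+1; - Posz n; - Posz n.+1]).
- exact: uniq_multiples.
- by case: (n) n0.
- move=> m; rewrite !inE => /or4P[] /eqP ->; rewrite ?rmorphN /= ?sqrrN; lra.
rewrite !big_cons big_nil !rmorphN /= !sqrrN.
rewrite -[(Posz n)%:~R]/(n%:R) -[(Posz n.+1)%:~R]/(n.+1%:R); lra.
Qed.

Theorem planar_optimality p q t : reduced p q t ->
  (F s s (s / 2) < F p q t)%E \/ [/\ p = s, q = s & t = s / 2].
Proof.
move=> red; have p0 := reduced_gt0 red.
case: (red) => /andP[t0 tp] pq det.
have [p1|p1] := ltP p (1 / 2); first by left; exact: cusp_energy.
have [r1|r1] := leP (p + q - 2 * t) (137 / 100); last by left; exact: far_energy.
have heron : 2 * (p * q + q * (p + q - 2 * t) + (p + q - 2 * t) * p)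
   - (p ^+ 2 + q ^+ 2 + (p + q - 2 * t) ^+ 2) = 4.
  by lra.
have [S0|S0] := ltP (3 * s) (p + q + (p + q - 2 * t)).
  by left; exact: near_energy.
right; have S1 : p + q + (p + q - 2 * t) - 3 * s = 0.
  apply/eqP; rewrite subr_eq0 eq_le S0 /=.
  by apply: heron_sum_ge heron; lra.
have := heron_defect heron; rewrite S1 mulr0 expr0n /= mul0r addr0.
move/eqP; rewrite paddr_eq0 ?addr_ge0 ?sqr_ge0// paddr_eq0 ?sqr_ge0//.
rewrite !sqrf_eq0 !subr_eq0 => /andP[/andP[/eqP pE /eqP qE] /eqP rE].
by split=> //; rewrite pE qE in rE; lra.
Qed.

End Planar.

(** * Bases of plane lattices *)

Section Plane.
Variable R : realType.
Implicit Types (P Q u v w : 'rV[R]_2).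

Definition dot u v : R := u 0 0 * v 0 0 + u 0 1 * v 0 1.
Definition cross u v : R := u 0 0 * v 0 1 - u 0 1 * v 0 0.

Lemma rowP2 P Q : P 0 0 = Q 0 0 -> P 0 1 = Q 0 1 -> P = Q.
Proof.
move=> e0 e1; apply/rowP => i; case: (unliftP 0 i) => [j ->|->//].
by rewrite (ord1 j) (_ : lift 0 0 = 1)//; apply: val_inj.
Qed.

Lemma enorm_sqr P : enorm P ^+ 2 = dot P P.
Proof.
rewrite /enorm sqr_sqrtr; last by apply: sumr_ge0 => i _; exact: sqr_ge0.
rewrite !big_ord_recl big_ord0 addr0 /dot !expr2.
by rewrite (_ : lift ord0 ord0 = 1)//; apply: val_inj.
Qed.

Lemma det_basis u v : \det (basis_mx u v) = cross u v.
Proof.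
rewrite /basis_mx (expand_det_row _ 0) !big_ord_recl big_ord0 addr0.
rewrite /cofactor !det_mx11 !mxE /= (_ : lift ord0 ord0 = 1); last exact: val_inj.
rewrite /cross expr0 expr1 mul1r mulN1r mulrN.
by congr (_ * v _ _ - _ * v _ _); apply: val_inj.
Qed.

Lemma dot_cross u v : dot u u * dot v v - dot u v ^+ 2 = cross u v ^+ 2.
Proof. by rewrite /dot /cross; ring. Qed.

Lemma dot_ge0 u : 0 <= dot u u.
Proof. by rewrite /dot -!expr2 addr_ge0 ?sqr_ge0. Qed.

Definition int_comb u v (k : int * int) : 'rV[R]_2 := k.1%:~R *: u + k.2%:~R *: v.

Lemma dot_int_comb u v k :
  dot (int_comb u v k) (int_comb u v k) = qform (dot u u) (dot v v) (- dot u v) k.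
Proof. by rewrite /dot /int_comb /qform !mxE; ring. Qed.

Lemma zspan_int_comb u v k : zspan u v (int_comb u v k).
Proof. by exists k.1, k.2. Qed.

Lemma zspanP u v P : zspan u v P <-> exists k, P = int_comb u v k.
Proof.
by split => [[m [n ->]]|[k ->]]; [exists (m, n)|exact: zspan_int_comb].
Qed.

Lemma zspan_sub u v u' v' : zspan u v u' -> zspan u v v' -> zspan u' v' `<=` zspan u v.
Proof.
move=> /zspanP[[a b] ->] /zspanP[[c d] ->] P /zspanP[[m n] ->].
apply/zspanP; exists (m * a + n * c, m * b + n * d).
by apply: rowP2; rewrite /int_comb !mxE /= !rmorphD !rmorphM /=; ring.
Qed.

Lemma zspan_eq u v u' v' : zspan u v u' -> zspan u v v' -> zspan u' v' u -> zspan u' v' v ->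
  zspan u v = zspan u' v'.
Proof. by move=> h1 h2 h3 h4; apply/seteqP; split; exact: zspan_sub. Qed.

Definition is_basis (L : set 'rV[R]_2) u v : Prop := L = zspan u v /\ cross u v ^+ 2 = 1.

Lemma lattice_basis L : lattice_of_area 1 L <-> exists u v, is_basis L u v.
Proof.
split => [[u [v [_ LE d1]]]|[u [v [LE c1]]]].
  exists u, v; split=> //; move: d1; rewrite det_basis => d1.
  by rewrite -real_normK ?num_real// d1 expr1n.
have n1 : `|cross u v| = 1.
  by apply/eqP; rewrite -sqrp_eq1// real_normK ?num_real// c1.
exists u, v; rewrite det_basis; split=> //.
by rewrite unitmxE det_basis unitfE -normr_eq0 n1 oner_eq0.
Qed.

Lemma basis_swap L u v : is_basis L u v -> is_basis L v u.
Proof.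
move=> [-> c]; split; last by rewrite -c /cross; ring.
apply: zspan_eq; apply/zspanP; [exists (0, 1)|exists (1, 0)|exists (0, 1)|exists (1, 0)];
  by rewrite /int_comb /= scale0r scale1r ?add0r ?addr0.
Qed.

Lemma basis_opp L u v : is_basis L u v -> is_basis L u (- v).
Proof.
move=> [-> c]; split; last by rewrite -c /cross !mxE; ring.
apply: zspan_eq; apply/zspanP; [exists (1, 0)|exists (0, -1)|exists (1, 0)|exists (0, -1)];
  by rewrite /int_comb /= ?mulrN1z ?scale0r ?scale1r ?scaleN1r ?opprK ?add0r ?addr0.
Qed.

Lemma basis_add L u v : is_basis L u v -> is_basis L u (v + u).
Proof.
move=> [-> c]; split; last by rewrite -c /cross !mxE; ring.
apply: zspan_eq; apply/zspanP; [exists (1, 0)|exists (1, 1)|exists (1, 0)|exists (-1, 1)];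
  by rewrite /int_comb /= ?mulrN1z ?scale0r ?scale1r ?scaleN1r ?addr0// 1?addrC ?addrK ?add0r.
Qed.

(** The coordinates of a lattice vector w in a basis of area 1 are, up to sign, cross
products of w with the basis, hence bounded by lengths.  So only finitely many
bases are at most as long as a given one. *)
Lemma shortest_basis L u0 v0 : is_basis L u0 v0 ->
  exists u v, is_basis L u v /\
    forall u' v', is_basis L u' v' -> dot u u + dot v v <= dot u' u' + dot v' v'.
Proof.
move=> b0; pose K := dot u0 u0 + dot v0 v0.
pose B := (Num.trunc K).+1.
have KB : K < B%:R by exact: truncnS_gt.
pose dec (i : 'I_(B + B).+1) : int := (i : nat)%:Z - B%:Z.
pose bas (i : 'I_(B + B).+1 * 'I_(B + B).+1) := int_comb u0 v0 (dec i.1, dec i.2).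
pose good i := `[< is_basis L (bas i.1) (bas i.2) >].
pose weight i := dot (bas i.1) (bas i.1) + dot (bas i.2) (bas i.2).
have decP (m : int) : (`|m| <= B)%N -> exists i, dec i = m.
  move=> mB; have lt : (absz (m + B%:Z)%R < (B + B).+1)%N by lia.
  by exists (Ordinal lt); rewrite /dec /=; lia.
have [i1 i1E] := decP 1 isT; have [i2 i2E] := decP 0 isT.
have e1 : bas (i1, i2) = u0 by rewrite /bas /int_comb /= i1E i2E scale1r scale0r addr0.
have e2 : bas (i2, i1) = v0 by rewrite /bas /int_comb /= i1E i2E scale1r scale0r add0r.
pose i0 := ((i1, i2), (i2, i1)).
have good0 : good i0 by apply/asboolP; rewrite /= e1 e2.
have weight0 : weight i0 = K by rewrite /weight /= e1 e2.
case: (@Order.TotalTheory.arg_minP _ _ _ i0 good weight good0) => i /asboolP gi imin.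
exists (bas i.1), (bas i.2); split=> // u v b.
have [big|small] := leP (dot u u + dot v v) K; last first.
  by apply: le_trans (ltW small); rewrite -weight0; exact: imin.
have coords w : L w -> dot w w <= K -> exists j, bas j = w.
  case: b0 => LE c1; rewrite LE => /zspanP[[m n] wE] wK.
  have K0 : 0 <= K by rewrite addr_ge0 ?dot_ge0.
  have bnd (a : int) : a%:~R ^+ 2 <= K * K -> (`|a| <= B)%N.
    rewrite -expr2 => aK.
    have aK' : `|a%:~R : R| <= K by rewrite -(@ler_pXn2r _ 2) ?nnegrE// real_normK ?num_real.
    have : `|a%:~R : R| <= B%:R by exact: le_trans (ltW KB).
    by rewrite -intr_norm -[B%:R]/((B%:Z)%:~R) ler_int; lia.
  have mE : m%:~R ^+ 2 = cross w v0 ^+ 2.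
    transitivity (m%:~R ^+ 2 * cross u0 v0 ^+ 2); first by rewrite c1 mulr1.
    by rewrite wE /cross /int_comb !mxE /=; ring.
  have nE : n%:~R ^+ 2 = cross u0 w ^+ 2.
    transitivity (n%:~R ^+ 2 * cross u0 v0 ^+ 2); first by rewrite c1 mulr1.
    by rewrite wE /cross /int_comb !mxE /=; ring.
  have crossK w1 w2 : dot w1 w1 <= K -> dot w2 w2 <= K -> cross w1 w2 ^+ 2 <= K * K.
    move=> h1 h2; rewrite -dot_cross; apply: (@le_trans _ _ (dot w1 w1 * dot w2 w2)).
      by rewrite gerBl sqr_ge0.
    by apply: ler_pM; rewrite ?dot_ge0.
  have mK : m%:~R ^+ 2 <= K * K by rewrite mE; apply: crossK; rewrite // lerDr dot_ge0.
  have nK : n%:~R ^+ 2 <= K * K by rewrite nE; apply: crossK; rewrite // lerDl dot_ge0.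
  have [j1 j1E] := decP m (bnd m mK); have [j2 j2E] := decP n (bnd n nK).
  by exists (j1, j2); rewrite /bas /= j1E j2E.
have Lu : L u by case: b => -> _; apply/zspanP; exists (1, 0); rewrite /int_comb /= scale1r scale0r addr0.
have Lv : L v by case: b => -> _; apply/zspanP; exists (0, 1); rewrite /int_comb /= scale1r scale0r add0r.
have uK : dot u u <= K by apply: le_trans big; rewrite lerDl dot_ge0.
have vK : dot v v <= K by apply: le_trans big; rewrite lerDr dot_ge0.
have [j jE] := coords u Lu uK; have [j' jE'] := coords v Lv vK.
rewrite -jE -jE'; apply: (imin (j, j')).
by apply/asboolP; rewrite /= jE jE'.
Qed.

(** In a shortest basis (u, v), ordered and with u.v <= 0, the vector v + u is not
shorter than v. *)
Lemma reduced_basis L : lattice_of_area 1 L ->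
  exists u v, is_basis L u v /\ reduced (dot u u) (dot v v) (- dot u v).
Proof.
move=> /lattice_basis[u0 [v0 /shortest_basis[u [v [b bmin]]]]].
wlog uv : u v b bmin / dot u u <= dot v v.
  move=> H; have [uv|/ltW vu] := leP (dot u u) (dot v v); first exact: H uv.
  by apply: (H v u) => //; [exact: basis_swap|rewrite addrC].
have dotNN w : dot (- w) (- w) = dot w w by rewrite /dot !mxE; ring.
wlog d0 : v b bmin uv / dot u v <= 0.
  move=> H; have [d0|/ltW d0] := leP (dot u v) 0; first exact: H d0.
  apply: (H (- v)); rewrite ?dotNN//; first exact: basis_opp.
  by rewrite (_ : dot u (- v) = - dot u v) ?oppr_le0// /dot !mxE; ring.
exists u, v; split=> //; split=> //.
  apply/andP; split; first by rewrite mulr_ge0// oppr_ge0.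
  have := bmin u (v + u) (basis_add b).
  rewrite (_ : dot (v + u) (v + u) = dot v v + 2 * dot u v + dot u u); first by lra.
  by rewrite /dot !mxE; ring.
by rewrite sqrrN dot_cross; case: b.
Qed.

End Plane.

(** * Energies of lattices *)

Section Energy.
Variable R : realType.
Local Notation s := (hexlen R).
Local Notation h := (@decay R).
Implicit Types (P Q u v w : 'rV[R]_2) (L : set 'rV[R]_2) (f : R -> R).

Lemma energy_nonneg f L : (forall x, 0 <= x -> 0 <= f x) ->
  energy f L = (\esum_(P in L `\ 0%R) (f (enorm P ^+ 2))%:E)%E.
Proof.
move=> f0; rewrite /energy [X in (_ - X)%E]esum1 ?sube0.
  by apply: eq_esum => P _; rewrite max_l// f0 ?sqr_ge0.
by move=> P _; rewrite max_r// oppr_le0 f0 ?sqr_ge0.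
Qed.

Lemma dot_eq0 P : dot P P = 0 -> P = 0.
Proof.
rewrite /dot -!expr2 => /eqP; rewrite paddr_eq0 ?sqr_ge0// !sqrf_eq0.
by move=> /andP[/eqP e0 /eqP e1]; apply: rowP2; rewrite mxE.
Qed.

Lemma int_comb_bij u v : reduced (dot u u) (dot v v) (- dot u v) ->
  set_bij nonzero (zspan u v `\ 0%R) (int_comb u v).
Proof.
move=> red.
have int_comb_eq0 k : int_comb u v k = 0 -> k = (0, 0).
  move=> k0; apply/eqP/negPn/negP => kn.
  have := qform_gt0 red kn; rewrite -dot_int_comb k0 /dot !mxE mulr0 addr0 ltxx.
  by [].
split.
- move=> k k0; split; first exact: zspan_int_comb.
  by move=> /int_comb_eq0 kE; move: k0; rewrite kE.
- move=> [m n] [m' n'] _ _ e.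
  have /int_comb_eq0 [] : int_comb u v (m - m', n - n') = 0.
    have -> : int_comb u v (m - m', n - n') = int_comb u v (m, n) - int_comb u v (m', n').
      by apply: rowP2; rewrite /int_comb !mxE /= !rmorphB /=; ring.
    by rewrite e subrr.
  by move=> /eqP + /eqP; rewrite !subr_eq0 => /eqP -> /eqP ->.
- move=> P [/zspanP[k ->] k0]; exists k => //.
  apply/eqP => kE; apply: k0.
  by rewrite kE /int_comb /= !scale0r addr0.
Qed.

Lemma energy_reduced f u v : (forall x, 0 <= x -> 0 <= f x) ->
  reduced (dot u u) (dot v v) (- dot u v) ->
  energy f (zspan u v) =
  (\esum_(k in nonzero) (f (qform (dot u u) (dot v v) (- dot u v) k))%:E)%E.
Proof.
move=> f0 red; rewrite energy_nonneg// (reindex_esum _ _ _ _ (int_comb_bij red)).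
by apply: eq_esum => k _; rewrite enorm_sqr dot_int_comb.
Qed.

Lemma zspan0 u v : zspan u v 0.
Proof. by exists 0, 0; rewrite !scale0r addr0. Qed.

Lemma zspanD u v P Q : zspan u v P -> zspan u v Q -> zspan u v (P + Q).
Proof.
move=> [a [b ->]] [c [d ->]]; exists (a + c), (b + d).
by rewrite !rmorphD /= !scalerDl addrACA.
Qed.

Lemma zspanN u v P : zspan u v P -> zspan u v (- P).
Proof.
move=> [a [b ->]]; exists (- a), (- b).
by rewrite !rmorphN /= !scaleNr opprD.
Qed.

Lemma enorm_eq0 P : enorm P = 0 -> P = 0.
Proof. by move=> e; apply: dot_eq0; rewrite -enorm_sqr e expr0n. Qed.

(** The isometry may move the origin to another point of the lattice; translating it
back preserves the lattice. *)
Lemma energy_isometric f u v u' v' :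
  isometric (zspan u v) (zspan u' v') -> energy f (zspan u' v') = energy f (zspan u v).
Proof.
move=> [g gn gL]; pose c := g 0; pose g' P := g P - c.
have Lc : zspan u' v' c by rewrite -gL; exists 0 => //; exact: zspan0.
have gn0 P : enorm (g' P) = enorm P by rewrite /g' gn subr0.
have bij : set_bij (zspan u v `\ 0%R) (zspan u' v' `\ 0%R) g'.
  split.
  - move=> P [LP P0]; split.
      by apply: zspanD; [rewrite -gL; exists P|exact: zspanN].
    move=> /= gP0; apply: P0; apply: enorm_eq0; rewrite -gn0 gP0.
    by rewrite /enorm big1 ?sqrtr0// => i _; rewrite mxE expr0n.
  - move=> P Q _ _ e; apply/eqP; rewrite -subr_eq0; apply/eqP/enorm_eq0.
    have -> : enorm (P - Q) = enorm (g' P - g' Q) by rewrite -gn /g' opprB addrA subrK.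
    by rewrite e subrr /enorm big1 ?sqrtr0// => i _; rewrite mxE expr0n.
  - move=> Q [LQ Q0]; have : zspan u' v' (Q + c) by exact: zspanD.
    rewrite -gL => -[P LP gP]; exists P; last by rewrite /g' gP addrK.
    split=> // /= P0; apply: Q0; rewrite /= -[Q](addrK c) -gP P0 /c subrr.
    by [].
rewrite /energy; congr (_ - _)%E; rewrite (reindex_esum _ _ _ _ bij);
  by apply: eq_esum => P _; rewrite gn0.
Qed.

Lemma esumZl (T : choiceType) (A : set T) (a : T -> \bar R) (c : R) :
  0 < c -> (forall x, A x -> (0 <= a x)%E) ->
  (\esum_(x in A) (c%:E * a x) = c%:E * \esum_(x in A) a x)%E.
Proof.
move=> c0 a0; apply/eqP; rewrite eq_le esumZl_le ?(ltW c0)//=.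
have ci0 : 0 <= c^-1 by rewrite invr_ge0 ltW.
have ca0 x : A x -> (0 <= c%:E * a x)%E by move=> Ax; rewrite mule_ge0 ?a0// lee_fin ltW.
have := esumZl_le ci0 ca0.
rewrite (eq_esum (b := a)); last first.
  by move=> x _; rewrite muleA -EFinM mulVf ?gt_eqF// mul1e.
move=> H; apply: le_trans (lee_wpmul2l _ H) _; first by rewrite lee_fin ltW.
by rewrite muleA -EFinM mulfV ?gt_eqF// mul1e.
Qed.

Section Potential.
Variables alpha b : R.
Hypotheses (halpha : 1 <= alpha) (hb : 0 <= b).

Definition rate : R := pi * alpha - 157 / 50.
(** The profile of the potential: [Ipot] is [amplitude * decay * ratio]. *)
Definition ratio (x : R) : R := expR (- (rate * (x - s))) * ((s + b) / (x + b)).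
Definition ratio_slope (c : R) : R := rate + (c + b)^-1.

Lemma rate_ge0 : 0 <= rate.
Proof.
rewrite subr_ge0; apply: le_trans (pi_ge314 R) _.
by rewrite ler_peMr ?pi_ge0.
Qed.

(** For the tangent at c: with w = (x - c) / (c + b) the ratio of the values at x and c is
e^(- rate (x - c)) / (1 + w), and 1 + w <= e^w. *)
Lemma ratio_profile : profile ratio ratio_slope.
Proof.
have s0 := hexlen_gt0 R.
split.
- move=> x x0; rewrite /ratio mulr_gt0 ?expR_gt0// divr_gt0//.
    by rewrite ltr_wpDr.
  by rewrite ltr_wpDr.
- rewrite /ratio subrr mulr0 oppr0 expR0 mul1r divff//.
  by rewrite gt_eqF// ltr_wpDr.
- by move=> c c0; rewrite addr_ge0 ?rate_ge0// invr_ge0 addr_ge0// ltW.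
move=> c x c0 x0; rewrite /ratio /ratio_slope.
have cb : 0 < c + b by rewrite ltr_wpDr.
have xb : 0 < x + b by rewrite ltr_wpDr.
have sb : 0 < s + b by rewrite ltr_wpDr.
pose w := (x - c) / (c + b).
have w1 : 0 < 1 + w.
  rewrite /w (_ : 1 + _ = (x + b) / (c + b)) ?divr_gt0//.
  by field; rewrite gt_eqF.
rewrite [leRHS](_ : _ = expR (- (rate * (c - s))) * ((s + b) / (c + b)) *
    (expR (- (rate * (x - c))) / (1 + w))); last first.
  rewrite (_ : - (rate * (x - s)) = - (rate * (c - s)) + - (rate * (x - c))); last by ring.
  rewrite expRD /w; field.
  by rewrite !gt_eqF//= (_ : c + b + (x - c) = x + b) ?gt_eqF//; ring.
rewrite ler_pM2l; last by rewrite mulr_gt0 ?expR_gt0// divr_gt0.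
rewrite ler_pdivlMr//.
apply: (@le_trans _ _ (expR (- (rate * (x - c)) - w) * (1 + w))).
  rewrite ler_pM2r//; apply: le_trans (expR_ge1Dx _).
  by rewrite /w le_eqVlt; apply/orP; left; apply/eqP; ring.
rewrite expRD -mulrA ger_pMr ?expR_gt0//.
rewrite expRN mulrC ler_pdivrMr ?expR_gt0// mul1r; exact: expR_ge1Dx.
Qed.

Lemma Ipot_ge0 x : 0 <= x -> 0 <= Ipot alpha b x.
Proof. by move=> x0; rewrite /Ipot mulr_ge0 ?expR_ge0// divr_ge0// addr_ge0. Qed.

Definition amplitude : R := expR (- (pi * alpha * s)) / (s + b).

Lemma amplitude_gt0 : 0 < amplitude.
Proof. by rewrite divr_gt0 ?expR_gt0// ltr_wpDr// hexlen_gt0. Qed.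

Lemma Ipot_profile x : Ipot alpha b x = amplitude * (h x * ratio x).
Proof.
have sb : 0 < s + b by rewrite ltr_wpDr// hexlen_gt0.
rewrite /Ipot /amplitude /ratio /decay /rate.
rewrite (_ : - (pi * alpha * x) = - (pi * alpha * s) + - (157 / 50 * (x - s)) +
  - ((pi * alpha - 157 / 50) * (x - s))); last by ring.
rewrite !expRD; move: (expR _) (expR (- (157 / 50 * _))) (expR _) ((x + b)^-1) => e1 e2 e3 y.
by field; rewrite gt_eqF.
Qed.

Lemma energy_Ipot u v : reduced (dot u u) (dot v v) (- dot u v) ->
  energy (Ipot alpha b) (zspan u v) =
  (amplitude%:E * form_energy ratio (dot u u) (dot v v) (- dot u v))%E.
Proof.
move=> red; rewrite energy_reduced//; last exact: Ipot_ge0.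
rewrite /form_energy -esumZl ?amplitude_gt0//.
  by apply: eq_esum => k _; rewrite Ipot_profile EFinM.
move=> k k0; have q0 := qform_gt0 red k0; rewrite lee_fin mulr_ge0 ?ltW ?decay_gt0//.
by case: ratio_profile => r0 _ _ _; exact: r0.
Qed.

End Potential.

Local Notation c := (Num.sqrt (2 / Num.sqrt 3) : R).
Local Notation r3 := (Num.sqrt 3 : R).

(** A basis with an obtuse angle, hence reduced. *)
Definition hexa1 : 'rV[R]_2 := c *: vec2 1 0.
Definition hexa2 : 'rV[R]_2 := c *: vec2 (- 1 / 2) (r3 / 2).

Lemma scale_sqr : c ^+ 2 = s.
Proof. by rewrite sqr_sqrtr// ltW// hexlen_gt0. Qed.

Lemma root3_sqr : r3 ^+ 2 = 3. Proof. by rewrite sqr_sqrtr. Qed.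

Lemma hexagonal_zspan : hexagonal_lattice R = zspan hexa1 hexa2.
Proof.
have coord (m n : int) : c *: (m%:~R *: vec2 1 0 + n%:~R *: vec2 (1 / 2) (r3 / 2)) =
    (m + n)%:~R *: hexa1 + n%:~R *: hexa2.
  by apply: rowP2; rewrite /hexa1 /hexa2 !mxE /= rmorphD /=; field.
apply/seteqP; split => [_ [_ [m [n ->]] <-]|_ [m [n ->]]].
  by exists (m + n), n; rewrite coord.
exists ((m - n)%:~R *: vec2 1 0 + n%:~R *: vec2 (1 / 2) (r3 / 2)).
  by exists (m - n), n.
by rewrite coord subrK.
Qed.

Lemma hexa_dots : [/\ dot hexa1 hexa1 = s, dot hexa2 hexa2 = s & dot hexa1 hexa2 = - (s / 2)].
Proof.
rewrite /dot /hexa1 /hexa2 !mxE /= -scale_sqr; have r := root3_sqr.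
split; [by ring| |by ring].
rewrite (_ : _ + _ = c ^+ 2 * ((1 + r3 ^+ 2) / 4)); last by field.
by rewrite r; field.
Qed.

Lemma hexa_reduced : reduced (dot hexa1 hexa1) (dot hexa2 hexa2) (- dot hexa1 hexa2).
Proof. by have [-> -> ->] := hexa_dots; rewrite opprK; exact: reduced_hex. Qed.

Lemma hexagonal_area : lattice_of_area 1 (hexagonal_lattice R).
Proof.
apply/lattice_basis; exists hexa1, hexa2; split; first exact: hexagonal_zspan.
rewrite -dot_cross; have [-> -> ->] := hexa_dots.
by have := hexlen2 R; move: (s) => t; lra.
Qed.

(** The linear map sending [hexa1] to u and [hexa2] to v; x and y are the coordinates in
the basis [hexa1], [hexa2]. *)
Lemma isometric_of_gram u v : dot u u = s -> dot v v = s -> dot u v = - (s / 2) ->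
  isometric (hexagonal_lattice R) (zspan u v).
Proof.
move=> uu vv uv.
have c0 : 0 < c by rewrite sqrtr_gt0 hexlen_gt0.
have r0 : 0 < r3 by rewrite sqrtr_gt0.
pose x P := (P 0 0 + P 0 1 / r3) / c.
pose y P := 2 * P 0 1 / (r3 * c).
pose g P := x P *: u + y P *: v.
have gB P Q : g P - g Q = g (P - Q).
  by rewrite /g /x /y !mxE; apply: rowP2; rewrite !mxE; field; rewrite !gt_eqF.
have gn P : enorm (g P) = enorm P.
  apply/eqP; rewrite -(@eqrXn2 _ 2) ?sqrtr_ge0// !enorm_sqr.
  have -> : dot (g P) (g P) = x P ^+ 2 * dot u u + 2 * x P * y P * dot u v + y P ^+ 2 * dot v v.
    by rewrite /dot /g !mxE; ring.
  rewrite uu vv uv -scale_sqr /x /y /dot.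
  rewrite (_ : _ + _ = P 0 0 ^+ 2 + (P 0 1 * P 0 1) * (3 / r3 ^+ 2)); last by field; rewrite !gt_eqF.
  by rewrite root3_sqr divff// mulr1 -expr2.
exists g; first by move=> P Q; rewrite gB gn.
have gh m n : g (m *: hexa1 + n *: hexa2) = m *: u + n *: v.
  rewrite /g (_ : x _ = m) 1?(_ : y _ = n)//.
    by rewrite /y /hexa1 /hexa2 !mxE /=; field; rewrite !gt_eqF.
  by rewrite /x /hexa1 /hexa2 !mxE /=; field; rewrite !gt_eqF.
rewrite hexagonal_zspan; apply/seteqP; split => [_ [_ [m [n ->]] <-]|_ [m [n ->]]].
  by rewrite gh; exists m, n.
by exists (m%:~R *: hexa1 + n%:~R *: hexa2); [exists m, n|rewrite gh].
Qed.

End Energy.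

Theorem corollary1p4 (R : realType) (alpha b : R)
    (halpha : 1 <= alpha) (hb : 0 <= b) :
  (exists L : set 'rV[R]_2,
     minimizer (energy (Ipot alpha b)) (lattice_of_area 1) L) /\
  (forall L : set 'rV[R]_2, lattice_of_area 1 L ->
     (minimizer (energy (Ipot alpha b)) (lattice_of_area 1) L <->
      isometric (hexagonal_lattice R) L)).
Proof.
set En := energy (Ipot alpha b).
have hexE : En (hexagonal_lattice R) =
    ((amplitude alpha b)%:E * form_energy (ratio alpha b) (hexlen R) (hexlen R) (hexlen R / 2))%E.
  rewrite hexagonal_zspan /En (energy_Ipot halpha hb (hexa_reduced R)).
  by have [-> -> ->] := hexa_dots R; rewrite opprK.
have strict L : lattice_of_area 1 L ->
    (En (hexagonal_lattice R) < En L)%E \/ isometric (hexagonal_lattice R) L.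
  move=> /reduced_basis[u [v [[-> _] red]]].
  have [lt|[uu vv uv]] := planar_optimality (ratio_profile halpha hb) red.
    left; rewrite hexE /En (energy_Ipot halpha hb red).
    by rewrite lte_pmul2l// lte_fin amplitude_gt0.
  by right; apply: isometric_of_gram => //; rewrite -uv opprK.
have isoE L : lattice_of_area 1 L -> isometric (hexagonal_lattice R) L ->
    En L = En (hexagonal_lattice R).
  move=> [u [v [_ -> _]]]; rewrite hexagonal_zspan; exact: energy_isometric.
have hexmin : minimizer En (lattice_of_area 1) (hexagonal_lattice R).
  split; first exact: hexagonal_area.
  by move=> L LA; have [/ltW//|iso] := strict L LA; rewrite (isoE L).
split; first by exists (hexagonal_lattice R).
move=> L LA; split => [[_ Lmin]|iso].
  have [lt|//] := strict L LA; have := Lmin _ (hexagonal_area R).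
  by rewrite leNgt lt.
by split=> // L' LA'; rewrite (isoE L)//; case: hexmin => _; exact.
Qed.
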